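(* Given a hypergraph $\mathcal H$ on a finite set $V$, one can find a coatom of $\operatorname{Mod}(\Phi_{\mathcal H})$, or determine that none exists, using at most $|V|+1$ closure computations. For a normalized input, the running time is $O(|V|\,L(\mathcal H))$, and the working space is $O(L(\mathcal H))$.
   Context: A hypergraph on a finite set $V$ is a family $\mathcal H\subseteq 2^V$, given by its incidence list; it is normalized if it has no repeated incidences, no duplicate hyperedges and no empty hyperedge. Put $L(\mathcal H)=|V|+|\mathcal H|+\sum_{A\in\mathcal H}|A|$. The associated definite Horn CNF is $\Phi_{\mathcal H}=\bigwedge_{A\in\mathcal H}\bigwedge_{v\in A}((A\setminus\{v\})\to v)$, with model family $\operatorname{Mod}(\Phi_{\mathcal H})\subseteq 2^V$ (models identified with sets of true variables). It is a closure system on $V$ containing $V$; a coatom is an inclusion-maximal member of $\operatorname{Mod}(\Phi_{\mathcal H})\setminus\{V\}$. For $Y\subseteq V$, $\operatorname{cl}_{\mathcal H}(Y)=\bigcap\{M\in\operatorname{Mod}(\Phi_{\mathcal H}):Y\subseteq M\}$. A closure computation is the evaluation of $\operatorname{cl}_{\mathcal H}(Y)$ for one set $Y$; by forward chaining it takes $O(L(\mathcal H))$ time on a normalized hypergraph. *)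

(* Defs.v *)
From HB Require Import structures.
From mathcomp Require Import all_boot.

Set Implicit Arguments.
Unset Strict Implicit.
Unset Printing Implicit Defensive.

(** * Hypergraphs, Horn formulas and closures *)

(* A pair [(B, v)] encodes the definite Horn clause with body the conjunction
   of [B] and head [v]; a formula is a set of such clauses. *)
Definition satisfies (V : finType) (M : {set V}) (c : {set V} * V) : bool :=
  (c.1 \subset M) ==> (c.2 \in M).

Definition Mod (V : finType) (F : {set {set V} * V}) : {set {set V}} :=
  [set M | [forall c in F, satisfies M c]].

Definition Phi (V : finType) (E : {set {set V}}) : {set {set V} * V} :=
  [set (A :\ v, v) | A in E, v in A].

Definition coatom (V : finType) (E : {set {set V}}) (M : {set V}) : bool :=
  maxset (fun X => (X \in Mod (Phi E)) && (X != [set: V])) M.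

Definition cl (V : finType) (E : {set {set V}}) (Y : {set V}) : {set V} :=
  \bigcap_(M in Mod (Phi E) | Y \subset M) M.

(* An incidence list [H : seq (seq V)] lists the hyperedges, each one as the
   list of its vertices; it may contain repetitions and presents the family
   [edges H]. *)
Definition edges (V : finType) (H : seq (seq V)) : {set {set V}} :=
  [set:: [seq [set v in A] | A <- H]].

Definition normalized (V : finType) (H : seq (seq V)) : bool :=
  [&& all uniq H, uniq [seq [set v in A] | A <- H] & set0 \notin edges H].

Definition L (V : finType) (H : seq (seq V)) : nat :=
  #|V| + #|edges H| + \sum_(A in edges H) #|A|.

(** * A random access machine with closure calls *)

(* The memory is divided into named arrays of natural numbers.  [Input] is the
   read-only encoding of the hypergraph, [Query] carries the argument and the
   value of a closure computation, the [Main k] belong to the main program and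
   the [Work k] to the procedure computing closures. *)
Inductive arr : Type := Input | Query | Main of nat | Work of nat.

Definition arr_code (a : arr) : nat + nat + bool :=
  match a with
  | Input => inr false | Query => inr true
  | Main k => inl (inl k) | Work k => inl (inr k)
  end.

Definition arr_decode (c : nat + nat + bool) : arr :=
  match c with
  | inr false => Input | inr true => Query
  | inl (inl k) => Main k | inl (inr k) => Work k
  end.

Lemma arr_codeK : cancel arr_code arr_decode.
Proof. by case. Qed.

HB.instance Definition _ := Equality.copy arr (can_type arr_codeK).

Definition store : Type := arr -> nat -> nat.

Definition upd (st : store) (a : arr) (i x : nat) : store :=
  fun b j => if (b == a) && (j == i) then x else st b j.

Inductive expr : Type :=
  | Cst of nat
  | Read of arr & expr
  | Add of expr & expr
  | Sub of expr & expr.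

Inductive cmd : Type :=
  | Skip
  | Assign of arr & expr & expr    (* [Assign a e1 e2] is a[e1] := e2 *)
  | Seq of cmd & cmd
  | If of expr & cmd & cmd         (* a guard holds when it is nonzero *)
  | While of expr & cmd
  | Closure.

Fixpoint eval (st : store) (e : expr) : nat :=
  match e with
  | Cst k => k
  | Read a e1 => st a (eval st e1)
  | Add e1 e2 => eval st e1 + eval st e2
  | Sub e1 e2 => eval st e1 - eval st e2
  end.

(* Number of elementary operations performed to evaluate [e]. *)
Fixpoint esize (e : expr) : nat :=
  match e with
  | Cst _ => 1
  | Read _ e1 => (esize e1).+1
  | Add e1 e2 | Sub e1 e2 => (esize e1 + esize e2).+1
  end.

(* Each event costs one unit of time. *)
Inductive event : Type :=
  | EOp
  | EWrite of arr & nat & nat      (* array, index, value *)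
  | EClosure.

(* [exec call c st tr st']: started in [st], the command [c] halts in [st'],
   producing the trace [tr].  The relation [call] gives the meaning of the
   command [Closure]. *)
Inductive exec (call : store -> seq event -> store -> Prop) :
    cmd -> store -> seq event -> store -> Prop :=
  | ExecSkip st : exec call Skip st [:: EOp] st
  | ExecAssign a e1 e2 st :
      exec call (Assign a e1 e2) st
        (nseq (esize e1 + esize e2) EOp
           ++ [:: EWrite a (eval st e1) (eval st e2)])
        (upd st a (eval st e1) (eval st e2))
  | ExecSeq c1 c2 st tr1 st1 tr2 st2 :
      exec call c1 st tr1 st1 -> exec call c2 st1 tr2 st2 ->
      exec call (Seq c1 c2) st (tr1 ++ tr2) st2
  | ExecIf e c1 c2 st tr st' :
      exec call (if eval st e != 0 then c1 else c2) st tr st' ->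
      exec call (If e c1 c2) st (nseq (esize e).+1 EOp ++ tr) st'
  | ExecWhileDone e c st :
      eval st e = 0 ->
      exec call (While e c) st (nseq (esize e).+1 EOp) st
  | ExecWhileLoop e c st tr1 st1 tr2 st2 :
      eval st e != 0 ->
      exec call c st tr1 st1 -> exec call (While e c) st1 tr2 st2 ->
      exec call (While e c) st (nseq (esize e).+1 EOp ++ tr1 ++ tr2) st2
  | ExecClosure st tr st' :
      call st tr st' -> exec call Closure st tr st'.

Fixpoint expr_scoped (rd : pred arr) (e : expr) : bool :=
  match e with
  | Cst _ => true
  | Read a e1 => rd a && expr_scoped rd e1
  | Add e1 e2 | Sub e1 e2 => expr_scoped rd e1 && expr_scoped rd e2
  end.

(* [c] reads only arrays in [rd], writes only arrays in [wr], and contains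
   closure calls only if [cc]. *)
Fixpoint scoped (rd wr : pred arr) (cc : bool) (c : cmd) : bool :=
  match c with
  | Skip => true
  | Assign a e1 e2 => [&& wr a, expr_scoped rd e1 & expr_scoped rd e2]
  | Seq c1 c2 => scoped rd wr cc c1 && scoped rd wr cc c2
  | If e c1 c2 =>
      [&& expr_scoped rd e, scoped rd wr cc c1 & scoped rd wr cc c2]
  | While e c1 => expr_scoped rd e && scoped rd wr cc c1
  | Closure => cc
  end.

(* The main program sees neither [Input] nor the arrays [Work k]: closure
   computations are its only access to the hypergraph.  Without this
   restriction, counting them would be meaningless. *)
Definition main_program (c : cmd) : bool :=
  let own a := match a with Query | Main _ => true | _ => false end in
  scoped own own true c.

Definition closure_procedure (c : cmd) : bool :=
  scoped (fun a => match a with Main _ => false | _ => true end)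
         (fun a => match a with Query | Work _ => true | _ => false end)
         false c.

(** * Resources used by a run *)

Definition time (tr : seq event) : nat := size tr.

Definition closure_computations (tr : seq event) : nat :=
  count (fun ev => if ev is EClosure then true else false) tr.

Definition written_cells (tr : seq event) : seq (arr * nat) :=
  pmap (fun ev => if ev is EWrite a i _ then Some (a, i) else None) tr.

Definition space (tr : seq event) : nat := size (undup (written_cells tr)).

(* All addresses and values stored during the run are at most [w]. *)
Definition words_bounded (w : nat) (tr : seq event) : bool :=
  all (fun ev => if ev is EWrite _ i x then (i <= w) && (x <= w) else true) tr.

(** * Inputs, outputs and closure calls *)

(* Vertices are numbered by [enum_rank]. *)
Definition encode (V : finType) (H : seq (seq V)) : seq nat :=
  [:: #|V|, size H
    & flatten [seq size A :: [seq val (enum_rank v) | v <- A] | A <- H]].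

(* The main program gets the number of vertices in [Main 0]; everything but
   the input is initially zero. *)
Definition init (V : finType) (H : seq (seq V)) : store :=
  fun a i => match a with
             | Input => nth 0 (encode H) i
             | Main 0 => if i == 0 then #|V| else 0
             | _ => 0
             end.

(* The set whose characteristic vector is held in array [a]. *)
Definition set_of (V : finType) (st : store) (a : arr) : {set V} :=
  [set v | st a (enum_rank v) != 0].

(* The output flag is cell 0 of [Main 1], and the output set is in [Main 2]. *)
Definition answer (V : finType) (st : store) : option {set V} :=
  if st (Main 1) 0 != 0 then Some (set_of V st (Main 2)) else None.

Definition correct (V : finType) (H : seq (seq V)) (r : option {set V}) : Prop :=
  match r with
  | Some M => coatom (edges H) M
  | None => forall M : {set V}, ~~ coatom (edges H) M
  end.

(* The store in which the set in [Query] has been replaced by its closure. *)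
Definition close_query (V : finType) (H : seq (seq V)) (st : store) : store :=
  fun a i =>
    match a, insub i : option 'I_#|V| with
    | Query, Some j => (enum_val j \in cl (edges H) (set_of V st Query)) : nat
    | _, _ => st a i
    end.

(* Closure calls answered by an oracle. *)
Definition oracle_call (V : finType) (H : seq (seq V))
    (st : store) (tr : seq event) (st' : store) : Prop :=
  tr = [:: EClosure] /\ st' = close_query H st.

(* Closure calls executed by the procedure [p]; the call is legal only if [p]
   does evaluate the closure of the set in [Query].  The array [Query] must
   match outside of the vertex range as well, so that [p] cannot pass any
   other information to the main program. *)
Definition procedure_call (V : finType) (H : seq (seq V)) (p : cmd)
    (st : store) (tr : seq event) (st' : store) : Prop :=
  exists tr' : seq event,
    [/\ exec (fun _ _ _ => False) p st tr' st',
        tr = EClosure :: tr'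
      & st' Query =1 close_query H st Query].

(* Main.v *)
Require Import Defs.
From mathcomp Require Import all_boot.
From mathcomp Require Import zify.

Set Implicit Arguments.
Unset Strict Implicit.
Unset Printing Implicit Defensive.

(** The main program is greedy.  It keeps a best candidate [Y], initially empty,
    and closes first [Y] and then [Y] extended by each vertex in turn: one
    closure more than there are vertices.  A closure other than the whole vertex
    set becomes the new [Y].  The first one tells whether a coatom exists: if it
    is everything, so are all closures, and no candidate is ever accepted.
    Otherwise [Y] is from then on a proper model, and a vertex that was rejected
    once has a total closure together with every later, larger [Y]; hence at the
    end every vertex outside [Y] generates everything, which is maximality
    ([progress_step], [progress_correct]).

    The closure procedure is forward chaining.  A hyperedge [A] fires as soon as
    at most one of its vertices is missing.  Each hyperedge has a counter of its
    vertices that have not been processed yet, and each vertex a linked list of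
    its occurrences.  Processing a vertex walks along its list and decrements
    counters; a counter reaching one triggers a scan of its hyperedge that marks
    what is missing.  A counter drops from two to one only once, so
    every hyperedge is scanned at most once and the total work is linear.

    All of this is one loop whose body has no inner loop: it scans one cell if a
    scan is pending, else visits one occurrence if a list is pending, else pops
    one vertex.  Each of the three steps lowers a single [potential] by at least
    one, which gives termination and the linear time bound together
    ([pop_step], [scan_step], [visit_step]).  The invariant squeezes the
    marked set between the query and its closure, and when nothing is pending
    the marked set is a model, hence the closure ([procedure_spec]).

    Space follows from the word bound: the programs write to a fixed
    finite list of arrays, at addresses bounded by the word size ([space_le]). *)

(** * Reasoning about runs and their costs *)

(** Total correctness with resources: some run from [st] halts in [Q], within
    time [t], at most [k] closure computations and word bound [w]. *)
Definition runs (call : store -> seq event -> store -> Prop) (w : nat)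
    (c : cmd) (st : store) (t k : nat) (Q : store -> Prop) : Prop :=
  exists tr st',
    [/\ exec call c st tr st', time tr <= t, closure_computations tr <= k,
        words_bounded w tr & Q st'].

(** Weakest preconditions for loop-free code, which evaluates symbolically; the
    remaining commands get [False] and are handled by [runs_while] and by the
    specification of closure calls. *)
Fixpoint wp (w : nat) (c : cmd) (Q : store -> Prop) (st : store) : Prop :=
  match c with
  | Skip => Q st
  | Assign a e1 e2 =>
      [/\ eval st e1 <= w, eval st e2 <= w
        & Q (upd st a (eval st e1) (eval st e2))]
  | Seq c1 c2 => wp w c1 (wp w c2 Q) st
  | If e c1 c2 => if eval st e != 0 then wp w c1 Q st else wp w c2 Q st
  | While _ _ | Closure => False
  end.

Fixpoint cost (c : cmd) : nat :=
  match c with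
  | Skip => 1
  | Assign _ e1 e2 => (esize e1 + esize e2).+1
  | Seq c1 c2 => cost c1 + cost c2
  | If e c1 c2 => (esize e).+1 + (cost c1 + cost c2)
  | While _ _ | Closure => 0
  end.

Section Logic.

Variables (call : store -> seq event -> store -> Prop) (w : nat).

Lemma runs_conseq c st t k (Q : store -> Prop) t' k' (Q' : store -> Prop) :
  t <= t' -> k <= k' -> (forall st', Q st' -> Q' st') ->
  runs call w c st t k Q -> runs call w c st t' k' Q'.
Proof.
move=> tt' kk' QQ' [tr [st' [run tr_t tr_k tr_w Qst']]].
exists tr, st'; split=> //; [exact: leq_trans tt' | exact: leq_trans kk' |].
exact: QQ'.
Qed.

Lemma closures_ops j tr :
  closure_computations (nseq j EOp ++ tr) = closure_computations tr.
Proof. by rewrite /closure_computations count_cat count_nseq. Qed.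

Lemma words_ops j tr : words_bounded w (nseq j EOp ++ tr) = words_bounded w tr.
Proof. by rewrite /words_bounded all_cat all_nseq orbT. Qed.

Lemma runs_if e c1 c2 st t k Q :
  runs call w (if eval st e != 0 then c1 else c2) st t k Q ->
  runs call w (If e c1 c2) st ((esize e).+1 + t) k Q.
Proof.
case=> tr [st' [run tr_t tr_k tr_w Qst']].
eexists _, st'; split; [exact: ExecIf run|..] => //.
- by rewrite /time size_cat size_nseq leq_add2l.
- by rewrite closures_ops.
- by rewrite words_ops.
Qed.

Lemma runs_seq c1 c2 st t1 k1 t2 k2 Q :
  runs call w c1 st t1 k1 (fun st1 => runs call w c2 st1 t2 k2 Q) ->
  runs call w (Seq c1 c2) st (t1 + t2) (k1 + k2) Q.
Proof.
case=> tr1 [st1 [run1 t1P k1P w1 [tr2 [st2 [run2 t2P k2P w2 Qst]]]]].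
exists (tr1 ++ tr2), st2; split=> //; first exact: ExecSeq run1 run2.
- by rewrite /time size_cat leq_add.
- by rewrite /closure_computations count_cat leq_add.
- by rewrite /words_bounded all_cat; apply/andP.
Qed.

Lemma runs_wp c st Q : wp w c Q st -> runs call w c st (cost c) 0 Q.
Proof.
elim: c Q st => [|a e1 e2|c1 IH1 c2 IH2|e c1 IH1 c2 IH2|e c _|] Q st //=.
- by move=> Qst; exists [:: EOp], st; split=> //; apply: ExecSkip.
- case=> bi bx Qst; eexists _, _; split; [exact: ExecAssign|..] => //.
  + by rewrite /time size_cat size_nseq addn1.
  + by rewrite closures_ops.
  + by rewrite words_ops /words_bounded /= bi bx.
- move=> /IH1 run1; apply: (@runs_seq _ _ _ _ 0 _ 0).
  by apply: runs_conseq run1 => // st1; apply: IH2.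
- move=> wp_c; apply: runs_if; case: ifP wp_c => _ => [/IH1|/IH2];
    apply: runs_conseq => //; [exact: leq_addr | exact: leq_addl].
Qed.

(** The index of the invariant is a measure that each iteration lowers, so it
    bounds the number of iterations and thereby the cost. *)
Lemma runs_while (I : nat -> store -> Prop) e c t k :
  (forall m st, I m st -> eval st e != 0 ->
     runs call w c st t k (fun st' => exists2 m', m' < m & I m' st')) ->
  forall m st, I m st ->
  runs call w (While e c) st (((esize e).+1 + t) * m + (esize e).+1) (k * m)
    (fun st' => (exists m', I m' st') /\ eval st' e = 0).
Proof.
move=> body m; have [b] := ubnP m; elim: b m => // b IH m; rewrite ltnS => mb st Ist.
have [e0|en0] := eqVneq (eval st e) 0.
  exists (nseq (esize e).+1 EOp), st.
  have -> : nseq (esize e).+1 EOp = nseq (esize e).+1 EOp ++ [::] by rewrite cats0.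
  split; rewrite ?closures_ops ?words_ops //.
  - by rewrite cats0; apply: ExecWhileDone.
  - by rewrite cats0 /time size_nseq leq_addl.
  - by split=> //; exists m.
have [tr1 [st1 [run1 t1 k1 w1 [m' m'm Ist1]]]] := body m st Ist en0.
have [tr2 [st2 [run2 t2 k2 w2 Qst2]]] := IH m' (leq_trans m'm mb) st1 Ist1.
exists (nseq (esize e).+1 EOp ++ tr1 ++ tr2), st2; split=> //.
- exact: ExecWhileLoop run1 run2.
- move: t1 t2; rewrite /time !size_cat size_nseq => t1 t2.
  have := leq_mul (leqnn ((esize e).+1 + t)) m'm; rewrite mulnS; lia.
- rewrite closures_ops /closure_computations count_cat.
  move: k1 k2; rewrite /closure_computations => k1 k2.
  have := leq_mul (leqnn k) m'm; rewrite mulnS; lia.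
- by rewrite words_ops /words_bounded all_cat; apply/andP.
Qed.

End Logic.

(** Unqualified, [Sub] is the constructor of subtypes. *)
Notation Minus := Defs.Sub.
Definition reg (r : arr) : expr := Read r (Cst 0).
Definition set_reg (r : arr) (e : expr) : cmd := Assign r (Cst 0) e.

Definition For (r : arr) (b : expr) (c : cmd) : cmd :=
  Seq (set_reg r (Cst 0))
      (While (Minus b (reg r)) (Seq c (set_reg r (Add (reg r) (Cst 1))))).

Lemma upd_same st a i x : upd st a i x a i = x.
Proof. by rewrite /upd !eqxx. Qed.

(** The second hypothesis says that the invariant does not mention the loop
    counter, which the loop itself resets and increments. *)
Lemma runs_for call w (I : nat -> store -> Prop) r b n c t k st :
  n <= w ->
  (forall i st x, I i st -> I i (upd st r 0 x)) ->
  (forall i st, I i st -> eval st b = n) ->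
  (forall i st, i < n -> st r 0 = i -> I i st ->
     runs call w c st t k (fun st' => I i.+1 st' /\ st' r 0 = i)) ->
  I 0 st ->
  runs call w (For r b c) st ((t + esize b + 20) * n.+1) (k * n) (I n).
Proof.
move=> nw Ir Ib body I0.
pose J m st := exists2 i, m = n - i & [/\ I i st, st r 0 = i & i <= n].
have step m st0 : J m st0 -> eval st0 (Minus b (reg r)) != 0 ->
    runs call w (Seq c (set_reg r (Add (reg r) (Cst 1)))) st0 (t + 6) (k + 0)
      (fun st' => exists2 m', m' < m & J m' st').
  case=> i -> [Ii ri iN] /=; rewrite (Ib _ _ Ii) ri subn_eq0 -ltnNge => ltin.
  apply: runs_seq; apply: runs_conseq (body i st0 ltin ri Ii) => //.
  move=> st1 [Ii1 ri1]; apply: runs_wp => /=; split=> //.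
    by rewrite ri1 addn1 (leq_trans ltin).
  exists (n - i.+1); first by rewrite ltn_sub2l.
  by exists i.+1; rewrite // upd_same ri1 addn1; split=> //; apply: Ir.
have init0 : runs call w (set_reg r (Cst 0)) st 3 0 (J n).
  apply: runs_wp => /=; split=> //; exists 0; first by rewrite subn0.
  by split=> //; [exact: Ir | rewrite upd_same].
have loop st0 (J0 : J n st0) := runs_while step J0.
apply: (@runs_conseq _ _ _ _ (3 + (((esize b + 3).+1 + (t + 6)) * n + (esize b + 3).+1)) (0 + k * n)) => //; first by rewrite mulnS; nia.
  by move=> st'; exact.
apply: runs_seq; apply: runs_conseq init0 => // st0 J0.
apply: runs_conseq (loop st0 J0) => //=; [lia | lia |].
move=> st' [[_ [i _ [Ii ri iN]]] /eqP].
rewrite (Ib _ _ Ii) ri subn_eq0 => ni.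
by have -> : n = i by apply/eqP; rewrite eqn_leq ni.
Qed.

(** * Parsing the incidence list *)

Section Counting.

Variables (T : eqType) (s : seq T).

Lemma count_split (a b : pred T) :
  count a s = count (fun z => a z && b z) s + count (fun z => a z && ~~ b z) s.
Proof.
by elim: s => //= z s' ->; case: (a z); case: (b z); lia.
Qed.

Lemma count_remove (a : pred T) y : uniq s -> y \in s -> a y ->
  count a s = (count (fun z => a z && (z != y)) s).+1.
Proof.
move=> us ys ay; rewrite (count_split a (pred1 y)).
suff -> : count (fun z => a z && pred1 y z) s = count_mem y s.
  by rewrite count_uniq_mem // ys.
by apply: eq_count => z /=; case: eqP => [->|]; rewrite ?ay ?andbF.
Qed.

End Counting.

Lemma iota_rcons i : iota 0 i.+1 = rcons (iota 0 i) i.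
Proof. by rewrite -cats1 -addn1 iotaD. Qed.

Section Parse.

Variables (x : nat -> nat) (N : nat).

(** The input, from its third word on, is a sequence of blocks: a header holding
    a length, then that many vertex numbers.  After reading [p] words, the parser
    state consists of the position of the last header, the number of vertices
    still to come in its block, and the number of headers read.  The same
    definition serves as the specification of the program that builds the
    adjacency lists, and it makes sense for any word sequence [x].  Position [0]
    is always a header, so that it can play the null pointer in lists of
    incidences. *)
Fixpoint parse (p : nat) : nat * nat * nat :=
  if p is p'.+1 then
    let: (q, r, h) := parse p' in
    if r is r'.+1 then (q, r', h) else (p', x p', h.+1)
  else (0, 0, 0).

Definition own p := (parse p).1.1.
Definition todo p := (parse p).1.2.
Definition heads p := (parse p).2.

Lemma todoS p : todo p.+1 = if todo p is r.+1 then r else x p.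
Proof. by rewrite /todo /=; case: (parse p) => [[q [|r]] h]. Qed.

Lemma ownS p : own p.+1 = if todo p is r.+1 then own p else p.
Proof. by rewrite /own /todo /=; case: (parse p) => [[q [|r]] h]. Qed.

Lemma headsS p : heads p.+1 = if todo p is r.+1 then heads p else (heads p).+1.
Proof. by rewrite /heads /todo /=; case: (parse p) => [[q [|r]] h]. Qed.

Lemma heads_mono p q : p <= q -> heads p <= heads q.
Proof.
move/subnKC <-; elim: (q - p) => [|d IH]; first by rewrite addn0.
by rewrite addnS headsS; case: (todo _) => [|_] //; apply: leqW.
Qed.

Lemma heads_le p : heads p <= p.
Proof. by elim: p => // p IH; rewrite headsS; case: (todo p) => [|_]; rewrite ?ltnS // leqW. Qed.

Lemma parse_block q i : todo q = 0 -> i <= x q ->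
  [/\ todo (q.+1 + i) = x q - i, own (q.+1 + i) = q
    & heads (q.+1 + i) = (heads q).+1].
Proof.
move=> q0; elim: i => [|i IH] ix.
  by rewrite addn0 todoS ownS headsS q0 subn0.
have [remi owni headsi] := IH (ltnW ix).
rewrite addnS todoS ownS headsS remi owni headsi.
by case E: (x q - i) => [|r]; [lia | split; lia].
Qed.

Lemma own_block p : todo p != 0 ->
  [/\ todo (own p) = 0, own p < p & p + todo p = (own p + x (own p)).+1].
Proof.
elim: p => // p IH; rewrite todoS ownS; case E: (todo p) IH => [|r] IH.
  by split=> //; rewrite addSn.
by have [o1 o2 o3] := IH isT; split=> //; lia.
Qed.

Definition incidence p := (p < N) && (todo p != 0).
Definition header p := (p < N) && (todo p == 0).

Lemma incP p : incidence p ->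
  [/\ header (own p), own p < p & p <= own p + x (own p)].
Proof.
case/andP=> pN rp; have [o1 o2 o3] := own_block rp.
by split=> //; [rewrite /header o1 eqxx andbT; lia | lia].
Qed.

Lemma inc_gt0 p : incidence p -> 0 < p.
Proof. by case: p => //; rewrite /incidence andbF. Qed.

Hypothesis todoN : todo N = 0.

Lemma header_block q : header q -> q + x q < N.
Proof.
case/andP=> qN /eqP rq; rewrite ltnNge; apply/negP=> Nx.
have [|r _ _] := @parse_block q (N - q.+1) rq; first by lia.
by move: r; rewrite subnKC // todoN; lia.
Qed.

Lemma header_inc q p : header q -> q < p <= q + x q -> incidence p /\ own p = q.
Proof.
move=> hq /andP[qp pq]; have := header_block hq; case/andP: hq => qN /eqP rq xN.
have [|rp op _] := @parse_block q (p - q.+1) rq; first by lia.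
rewrite subnKC // in rp op; split=> //; rewrite /incidence rp; lia.
Qed.

Lemma count_block q : header q ->
  count (fun p => incidence p && (own p == q)) (iota 0 N) = x q.
Proof.
move=> hq; have xN := header_block hq.
have -> : N = q.+1 + (x q + (N - (q + x q).+1)) by lia.
rewrite iotaD iotaD !count_cat add0n.
have no s : (forall p, p \in s -> ~~ (q < p <= q + x q)) ->
    count (fun p => incidence p && (own p == q)) s = 0.
  move=> out; apply/eqP; rewrite eqn0Ngt -has_count; apply/hasPn => p /out.
  by apply: contra => /andP[/incP[_ op1 op2] /eqP qp]; rewrite -{1}qp op1 -qp.
rewrite [X in X + _]no => [|p]; last by rewrite mem_iota; lia.
rewrite [X in _ + (_ + X)]no => [|p]; last by rewrite mem_iota; lia.
rewrite add0n addn0 -[RHS](size_iota q.+1 (x q)); apply/eqP.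
rewrite -all_count; apply/allP => p; rewrite mem_iota => pq.
by have [|-> ->] := @header_inc q p hq; [lia | rewrite eqxx].
Qed.

(** The program knows the number of blocks but not the length of the input: the
    input is exhausted exactly when no header and no vertex is left to read. *)
Lemma parse_end p : p <= N -> (p == N) = (heads N - heads p + todo p == 0).
Proof.
move=> pN; have [-> |pnN] := eqVneq p N; first by rewrite subnn todoN.
have ltpN : p.+1 <= N by rewrite ltn_neqAle pnN.
have := heads_mono ltpN; rewrite headsS; case: (todo p) => [|r]; lia.
Qed.

(** The position of the last occurrence of [v] before [p], or [0].  The linked
    list of the occurrences of [v] is described by iterating this function. *)
Fixpoint last_occ v p :=
  if p is p'.+1 then if incidence p' && (x p' == v) then p' else last_occ v p' else 0.

Lemma last_occ_inc v p : last_occ v p != 0 ->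
  [/\ incidence (last_occ v p), x (last_occ v p) = v & last_occ v p < p].
Proof.
elim: p => //= p IH; case: ifP => [/andP[ip /eqP xp] _|_ /IH[? ? ?]].
  by split.
by split=> //; apply: leqW.
Qed.

Lemma last_occ_max v p q : incidence q -> x q = v -> q < p -> q <= last_occ v p.
Proof.
move=> iq xq; elim: p => //= p IH; rewrite ltnS leq_eqVlt => /orP[/eqP <-|qp].
  by rewrite iq xq eqxx.
by case: ifP => _; [apply: ltnW | apply: IH].
Qed.

Lemma last_occ_le v p : last_occ v p <= p.
Proof. by elim: p => //= p IH; case: ifP => _ //; apply: leqW. Qed.

End Parse.

(** * The closure procedure *)

(** Hyperedges are named by the positions of their headers.  [rPos], [rLeft],
    [rRem] and [rOwn] mirror the parser state; [aHead] and [aNext] are the lists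
    of occurrences, [aOwn] maps an occurrence to its hyperedge and [aCount] holds
    the counters.  In the chaining loop [rRem] cells are left to scan from
    [rScan] on, [rCur] is the next occurrence of [rVert] to visit, and the
    [rTop] entries of [aStack] are marked vertices waiting to be processed. *)
Notation rPos := (Work 0).
Notation rLeft := (Work 1).
Notation rRem := (Work 2).
Notation rOwn := (Work 3).
Notation aHead := (Work 4).
Notation aNext := (Work 5).
Notation aOwn := (Work 6).
Notation aCount := (Work 7).
Notation aStack := (Work 8).
Notation rTop := (Work 9).
Notation rCur := (Work 10).
Notation rVert := (Work 11).
Notation rScan := (Work 12).

(** Positions are relative to the third word of the input, after the numbers of
    vertices and hyperedges. *)
Definition word_at (e : expr) : expr := Read Input (Add e (Cst 2)).
Definition incr (r : arr) : cmd := set_reg r (Add (reg r) (Cst 1)).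
Definition decr (r : arr) : cmd := set_reg r (Minus (reg r) (Cst 1)).
Notation "c1 ;; c2" := (Seq c1 c2) (at level 60, right associativity).

Definition num_vertices : expr := Read Input (Cst 0).

Definition clear_code : cmd :=
  For rPos num_vertices (Assign aHead (reg rPos) (Cst 0)).

Definition build_body : cmd :=
  If (reg rRem)
     (* The counter of a singleton never drops to one, so its vertex is marked
        here. *)
     (If (Minus (word_at (reg rOwn)) (Cst 1)) Skip
         (Assign Query (word_at (reg rPos)) (Cst 1)) ;;
      Assign aNext (reg rPos) (Read aHead (word_at (reg rPos))) ;;
      Assign aHead (word_at (reg rPos)) (reg rPos) ;;
      Assign aOwn (reg rPos) (reg rOwn) ;;
      decr rRem)
     (set_reg rOwn (reg rPos) ;;
      set_reg rRem (word_at (reg rPos)) ;;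
      Assign aCount (reg rPos) (word_at (reg rPos)) ;;
      decr rLeft) ;;
  incr rPos.

Definition build_init : cmd :=
  set_reg rPos (Cst 0) ;; set_reg rLeft (Read Input (Cst 1)) ;;
  set_reg rRem (Cst 0) ;; set_reg rOwn (Cst 0).

Definition build_code : cmd :=
  build_init ;; While (Add (reg rLeft) (reg rRem)) build_body.

Definition push (e : expr) : cmd :=
  Assign Query e (Cst 1) ;; Assign aStack (reg rTop) e ;; incr rTop.

Definition push_code : cmd :=
  set_reg rTop (Cst 0) ;;
  For rPos num_vertices (If (Read Query (reg rPos)) (push (reg rPos)) Skip).

Definition scan_code : cmd :=
  If (Read Query (word_at (reg rScan))) Skip (push (word_at (reg rScan))) ;;
  incr rScan ;; decr rRem.

(** The scan is triggered by a counter equal to one, not at most one: a counter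
    going from one to zero must not trigger a second scan of the hyperedge. *)
Definition visit_code : cmd :=
  set_reg rOwn (Read aOwn (reg rCur)) ;;
  Assign aCount (reg rOwn) (Minus (Read aCount (reg rOwn)) (Cst 1)) ;;
  set_reg rCur (Read aNext (reg rCur)) ;;
  If (Read aCount (reg rOwn))
     (If (Minus (Read aCount (reg rOwn)) (Cst 1)) Skip
         (set_reg rScan (Add (reg rOwn) (Cst 1)) ;;
          set_reg rRem (word_at (reg rOwn))))
     Skip.

Definition pop_code : cmd :=
  decr rTop ;; set_reg rVert (Read aStack (reg rTop)) ;;
  set_reg rCur (Read aHead (reg rVert)).

Definition chain_body : cmd :=
  If (reg rRem) scan_code (If (reg rCur) visit_code pop_code).

Definition chain_init : cmd :=
  set_reg rCur (Cst 0) ;; set_reg rRem (Cst 0).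

Definition chain_code : cmd :=
  chain_init ;; While (Add (reg rTop) (Add (reg rCur) (reg rRem))) chain_body.

Definition forward_chaining : cmd :=
  clear_code ;; build_code ;; push_code ;; chain_code.

Lemma wp_if w e c1 c2 Q st :
  wp w (If e c1 c2) Q st =
  if eval st e != 0 then wp w c1 Q st else wp w c2 Q st.
Proof. by []. Qed.

Section Correctness.

Variables (call : store -> seq event -> store -> Prop) (w : nat).
Variables (word : nat -> nat) (N : nat).
Let n := word 0.
Let m := word 1.
Let x p := word (p + 2).
Local Notation inc := (incidence x N).
Local Notation hdr := (header x N).
Local Notation last_occ := (last_occ x N).

Hypothesis todoN : todo x N = 0.
Hypothesis headsN : heads x N = m.
Hypothesis inc_lt : forall p, inc p -> x p < n.
Hypothesis w_ge : n + N < w.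

(** Being a model of the Horn formula, expressed on positions: if all other
    occurrences in a hyperedge carry vertices of [S], so does this one. *)
Definition saturated (S : nat -> Prop) : Prop :=
  forall p, inc p ->
    (forall p', inc p' -> own x p' = own x p -> p' != p -> S (x p')) -> S (x p).

Variables (S : nat -> Prop) (Q0 : nat -> nat).
Hypothesis S_closed : saturated S.
Hypothesis S_Q0 : forall v, v < n -> Q0 v != 0 -> S v.

(** [Q0] is the query; with [S] its closure, this squeezes the marked set between
    the two. *)
Record sandwiched st : Prop := {
  sw_input : st Input =1 word;
  sw_outside : forall v, n <= v -> st Query v = Q0 v;
  sw_above : forall v, v < n -> Q0 v != 0 -> st Query v != 0;
  sw_below : forall v, v < n -> st Query v != 0 -> S v }.

Lemma clear_runs st : st Input =1 word -> st Query =1 Q0 ->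
  runs call w clear_code st (30 * n.+1) 0
    (fun st' => sandwiched st' /\ forall v, v < n -> st' aHead v = 0).
Proof.
move=> st_in st_q.
pose I i st' := [/\ st' Input =1 word, st' Query =1 Q0
  & forall v, v < i -> st' aHead v = 0].
have step i st' : i < n -> st' rPos 0 = i -> I i st' ->
    runs call w (Assign aHead (reg rPos) (Cst 0)) st' 4 0
      (fun st'' => I i.+1 st'' /\ st'' rPos 0 = i).
  move=> lt_in pos [I1 I2 I3]; apply: runs_wp.
  rewrite /= /upd /= pos; split=> //; first lia.
  by split=> //; split=> //= v vi; case: eqP => // ?; apply: I3; lia.
apply: runs_conseq (runs_for _ _ _ step _) => //=; [lia | | lia |].
- move=> st' [I1 I2 I3]; split=> //.
  by split=> // v; rewrite ?I2 // => vn; apply: S_Q0.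
- by move=> i st' [I1 _ _]; rewrite I1.
Qed.

(** The state of the adjacency lists and counters once the words before [P] have
    been read. *)
Record built P st : Prop := {
  bt_sw : sandwiched st;
  bt_own : forall p, inc p -> p < P -> st aOwn p = own x p;
  bt_next : forall p, inc p -> p < P -> st aNext p = last_occ (x p) p;
  bt_head : forall v, v < n -> st aHead v = last_occ v P;
  bt_count : forall q, hdr q -> q < P -> st aCount q = x q;
  bt_unit : forall p, inc p -> p < P -> x (own x p) = 1 -> st Query (x p) != 0 }.

Lemma build_step P st : P < N -> built P st ->
  st rPos 0 = P -> st rLeft 0 = m - heads x P -> st rRem 0 = todo x P ->
  st rOwn 0 = own x P ->
  wp w build_body (fun st' => [/\ built P.+1 st', st' rPos 0 = P.+1,
   st' rLeft 0 = m - heads x P.+1, st' rRem 0 = todo x P.+1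
   & st' rOwn 0 = own x P.+1]) st.
Proof.
move=> PN [sw b_own b_next b_head b_cnt b_unit] sp sl sr so.
have inx p : st Input (p + 2) = x p by rewrite (sw_input sw).
have mN : m <= N by rewrite -headsN heads_le.
rewrite /= sr; case: ifP => [rP|/eqP rP].
- have iP : inc P by rewrite /incidence PN.
  have xPn := inc_lt iP; have [hP oP Po] := incP iP.
  have rPN : todo x P <= N.
    by have [_ _ rPE] := own_block rP; have := header_block todoN hP; lia.
  have rPS : todo x P - 1 = todo x P.+1.
    by rewrite todoS; case: (todo x P) rP => // r _; rewrite subn1.
  have oPS : own x P = own x P.+1 by rewrite ownS; case: (todo x P) rP.
  have hPS : heads x P = heads x P.+1 by rewrite headsS; case: (todo x P) rP.
  have last_le : last_occ (x P) P <= P by apply: last_occ_le.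
  have tPS : todo x P.+1 <= N by lia.
  (* Both branches below differ only in whether they mark the vertex. *)
  have bS st' : sandwiched st' -> st' aOwn =1 upd st aOwn P (own x P) aOwn ->
      st' aNext =1 upd st aNext P (last_occ (x P) P) aNext ->
      st' aHead =1 upd st aHead (x P) P aHead -> st' aCount =1 st aCount ->
      (forall v, v < n -> st Query v != 0 -> st' Query v != 0) ->
      (x (own x P) = 1 -> st' Query (x P) != 0) -> built P.+1 st'.
    move=> sw' e_own e_next e_head e_cnt e_q e_unit; split=> //.
    - move=> p ip; rewrite e_own /upd eqxx ltnS leq_eqVlt /=.
      by case: eqP => [->|_] //=; apply: b_own.
    - move=> p ip; rewrite e_next /upd eqxx ltnS leq_eqVlt /=.
      by case: eqP => [->|_] //=; apply: b_next.
    - move=> v vn; rewrite e_head /upd eqxx /= iP /= eq_sym.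
      by case: eqP => // _; apply: b_head.
    - move=> q hq; rewrite e_cnt ltnS leq_eqVlt; case: eqP => [qP|_].
        by move: hq rP; rewrite /header qP => /andP[_ ->].
      exact: b_cnt.
    - move=> p ip; rewrite ltnS leq_eqVlt; case: eqP => [->|_] //= pP px.
      by apply: e_q; [apply: inc_lt | apply: b_unit].
  rewrite /= /upd /= sp so sr sl !inx b_head // rPS addn1.
  case: ifP => unit.
    do 5 (split; [lia | lia |]); split=> //; last by rewrite hPS.
    apply: bS => //; last by move=> xo; rewrite xo in unit.
    by case: sw => *; split.
  do 6 (split; [lia | lia |]); split=> //; last by rewrite hPS.
  apply: bS => //=; try by move=> v; rewrite /= /upd.
  - case: sw => s1 s2 s3 s4; split=> //= v vn; case: (v =P x P) => // vE.
    + lia.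
    + exact: s2.
    + exact: s3.
    + move=> _; rewrite vE.
      apply: S_closed iP _ => p' ip' op' /eqP[].
      by have [_ ? ?] := incP ip'; rewrite -op' in unit oP Po; lia.
    + exact: s4.
  - by move=> v vn /= qv; case: (v =P x P).
  - by rewrite eqxx.
have hP : hdr P by rewrite /header PN rP.
have xP := header_block todoN hP.
have hPS : m - heads x P - 1 = m - heads x P.+1 by rewrite headsS rP; lia.
have tPS : x P = todo x P.+1 by rewrite todoS rP.
have oPS : P = own x P.+1 by rewrite ownS rP.
have xw : x P <= w by lia.
have mw : m - heads x P.+1 <= w by lia.
have Pw : P < w by lia.
rewrite /= /upd /= sp /= sl !inx /= addn1 hPS /=.
do 5 (split; [lia | lia |]); split=> //.
have nP p : inc p -> (p < P.+1) = (p < P).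
  move=> ip; rewrite ltnS leq_eqVlt; case: eqP => // pP.
  by move: ip; rewrite /incidence pP rP andbF.
split=> //=.
- by case: sw => *; split.
- by move=> p ip; rewrite nP //; apply: b_own.
- by move=> p ip; rewrite nP //; apply: b_next.
- by move=> v vn; rewrite b_head // /incidence rP andbF.
- by move=> q hq; rewrite ltnS leq_eqVlt; case: eqP => [->|_] //= ?; apply: b_cnt.
- by move=> p ip; rewrite nP //; apply: b_unit.
Qed.

Lemma build_runs st : sandwiched st -> (forall v, v < n -> st aHead v = 0) ->
  runs call w build_code st ((cost build_body + 30) * N.+1) 0 (built N).
Proof.
move=> sw heads0.
have mN : m <= N by rewrite -headsN heads_le.
pose J k st := exists2 P, k = N - P & [/\ P <= N, built P st &
  [/\ st rPos 0 = P, st rLeft 0 = m - heads x P, st rRem 0 = todo x P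
   & st rOwn 0 = own x P]].
have step k st0 : J k st0 -> eval st0 (Add (reg rLeft) (reg rRem)) != 0 ->
    runs call w build_body st0 (cost build_body) 0
      (fun st' => exists2 k', k' < k & J k' st').
  case=> P -> [PN bt [sp sl sr so]] /=; rewrite sl sr -headsN -parse_end // => PnN.
  have ltPN : P < N by rewrite ltn_neqAle PnN.
  apply: runs_conseq (runs_wp _ (build_step ltPN bt sp sl sr so)) => //.
  move=> st1 [bt1 sp1 sl1 sr1 so1]; exists (N - P.+1); first lia.
  by exists P.+1.
have start : runs call w build_init st (cost build_init) 0 (J N).
  apply: runs_wp; rewrite /= /upd /= (sw_input sw).
  do 3 (split; [lia | lia |]); split=> //.
  exists 0; first by rewrite subn0.
  split=> //; last by split=> //; rewrite subn0.
  by split=> //=; case: sw => *; split.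
have loop st0 (J0 : J N st0) := runs_while step J0.
apply: (@runs_conseq _ _ _ _ (cost build_init +
  ((6 + cost build_body) * N + 6)) (0 + 0 * N)) => //.
- by rewrite [cost build_init]/=; lia.
- by move=> st'; exact.
apply: runs_seq; apply: runs_conseq start => // st0 J0.
apply: runs_conseq (loop st0 J0) => // st' [[k [P _ [PN bt [sp sl sr so]]]]] /=.
move=> /eqP; rewrite sl sr -headsN -parse_end // => /eqP PN'.
by rewrite -PN'.
Qed.

Record pushed i st : Prop := {
  ps_built : built N st;
  ps_le1 : forall v, v < i -> st Query v <= 1;
  ps_stack : mkseq (st aStack) (st rTop 0) = [seq v <- iota 0 i | st Query v != 0] }.

Lemma mkseq_push (f : nat -> nat) k y :
  mkseq (fun j => if j == k then y else f j) k.+1 = rcons (mkseq f k) y.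
Proof.
rewrite mkseqS eqxx; congr (rcons _ y); apply/eq_in_map => j.
by rewrite mem_iota add0n => /andP[_ jk]; rewrite ltn_eqF.
Qed.

Lemma push_step i st : i < n -> st rPos 0 = i -> pushed i st ->
  wp w (If (Read Query (reg rPos)) (push (reg rPos)) Skip)
    (fun st' => pushed i.+1 st' /\ st' rPos 0 = i) st.
Proof.
move=> lt_in pos [[sw b1 b2 b3 b4 b5] le1 stk].
have top : st rTop 0 <= i.
  rewrite -(size_mkseq (st aStack) (st rTop 0)) stk size_filter.
  by apply: leq_trans (count_size _ _) _; rewrite size_iota.
rewrite /= pos; case: ifP => qi.
  rewrite /= /upd /= pos addn1.
  do 3 (split; [lia | lia |]); split=> //; split.
  - split=> //=.
    + case: sw => s1 s2 s3 s4; split=> //= v vn; case: (v =P i) => // vi.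
      * lia.
      * exact: s2.
      * exact: s3.
      * by move=> _; rewrite vi; apply: s4.
      * exact: s4.
    + by move=> p ip pN px; case: (_ =P i) => // _; auto.
  - by move=> v vi /=; case: eqP => // ?; apply: le1; lia.
  - change (mkseq (fun j => if j == st rTop 0 then i else st aStack j)
        (st rTop 0).+1 =
      [seq v <- iota 0 i.+1 | (if v == i then 1 else st Query v) != 0]).
    rewrite mkseq_push stk iota_rcons filter_rcons eqxx /=.
    congr (rcons _ i); apply: eq_in_filter => v; rewrite mem_iota => vi.
    by case: (v =P i) => // vE; lia.
split=> //; split=> //.
  move=> v; rewrite ltnS leq_eqVlt => /orP[/eqP ->|/le1 //].
  by move/eqP: qi => ->.
by rewrite stk iota_rcons filter_rcons qi.
Qed.

Lemma push_runs st : built N st ->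
  runs call w push_code st (60 * n.+1) 0 (pushed n).
Proof.
case=> sw b1 b2 b3 b4 b5.
have start : runs call w (set_reg rTop (Cst 0)) st 3 0 (pushed 0).
  apply: runs_wp; rewrite /= /upd /=; split=> //; split=> //=.
  by split=> //=; case: sw => *; split.
apply: (@runs_conseq _ _ _ _ (3 + 50 * n.+1) (0 + 0 * n)) => //; first lia.
  by move=> st'; exact.
apply: runs_seq; apply: runs_conseq start => // st0 J0.
apply: runs_conseq (runs_for _ _ _ (fun i st' lt_in pos Ii =>
  runs_wp _ (push_step lt_in pos Ii)) J0) => //=; [lia | lia | |].
- move=> i st' y [[sw' c1 c2 c3 c4 c5] ? ?]; split=> //; split=> //=.
  by case: sw' => *; split.
- by move=> i st' [[[-> ] ]].
Qed.
Definition stack st : seq nat := mkseq (st aStack) (st rTop 0).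

(** An occurrence has been visited when its vertex has been processed, or is
    being processed and has its list already walked past this point; lists run
    towards smaller positions. *)
Definition visited (st : store) p : bool :=
  [&& st Query (x p) != 0, x p \notin stack st
    & ~~ ((x p == st rVert 0) && (p <= st rCur 0))].

Definition unvisited_in st q : nat :=
  count (fun p => [&& inc p, own x p == q & ~~ visited st p]) (iota 0 N).

(** The scanned range and the hyperedges with at most one unvisited occurrence
    determine each other, up to marked vertices: this makes marking sound
    ([ch_scan]) and, when no scan is pending, complete ([ch_done]). *)
Record chaining st : Prop := {
  ch_sw : sandwiched st;
  ch_le1 : forall v, v < n -> st Query v <= 1;
  ch_own : forall p, inc p -> st aOwn p = own x p;
  ch_next : forall p, inc p -> st aNext p = last_occ (x p) p;
  ch_head : forall v, v < n -> st aHead v = last_occ v N;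
  ch_uniq : uniq (stack st);
  ch_stack : forall v, v \in stack st -> v < n /\ st Query v != 0;
  ch_cur : st rCur 0 != 0 ->
    [/\ inc (st rCur 0), x (st rCur 0) = st rVert 0,
        st Query (st rVert 0) != 0 & st rVert 0 \notin stack st];
  ch_count : forall q, hdr q -> st aCount q = unvisited_in st q;
  ch_scan : forall p, st rScan 0 <= p < st rScan 0 + st rRem 0 ->
    inc p /\ st aCount (own x p) <= 1;
  ch_done : forall p, inc p -> st aCount (own x p) <= 1 ->
    st Query (x p) != 0 \/ st rScan 0 <= p < st rScan 0 + st rRem 0 }.

(** Marking a vertex moves one unit from the third summand to the second.
    Starting a scan is paid for by the last summand, which counts the occurrences
    in hyperedges not yet scanned; everything else consumes a unit. *)
Definition potential st : nat :=
  st rRem 0 + st rTop 0 + count (fun v => st Query v == 0) (iota 0 n)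
  + count (fun p => inc p && ~~ visited st p) (iota 0 N)
  + count (fun p => inc p && (1 < st aCount (own x p))) (iota 0 N).

Lemma stack_le st : chaining st -> st rTop 0 <= n.
Proof.
case=> _ _ _ _ _ us stk _ _ _ _.
rewrite -(size_mkseq (st aStack) (st rTop 0)) -[n](size_iota 0).
by apply: uniq_leq_size us _ => v /stk[vn _]; rewrite mem_iota.
Qed.

Lemma pop_step st : chaining st -> st rRem 0 = 0 -> st rCur 0 = 0 ->
  st rTop 0 != 0 ->
  wp w pop_code (fun st' => chaining st' /\ potential st' < potential st) st.
Proof.
move=> ch r0 c0 t0; have topn := stack_le ch.
case: ch => sw le1 e_own e_next e_head us stk _ cnt scan don.
case topE: (st rTop 0) t0 topn => [//|k] _ topn.
rewrite /= /upd /= topE subn1 /=.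
set v := st aStack k.
(* The popped vertex leaves the stack but none of its list is walked yet, so
   that no occurrence becomes visited. *)
have stackE : stack st = rcons (mkseq (st aStack) k) v.
  by rewrite /stack topE mkseqS.
have [vn qv] : v < n /\ st Query v != 0.
  by apply: stk; rewrite stackE mem_rcons inE eqxx.
have hv := e_head v vn; have hvN := last_occ_le x N v N.
do 3 (split; [lia | lia |]).
set st' : store := fun _ _ => _.
have visE p : inc p -> visited st' p = visited st p.
  move=> ip; rewrite /visited stackE /stack /st' /= mem_rcons inE c0 hv.
  rewrite leqn0 [p == 0]gtn_eqF ?(inc_gt0 ip) // andbF andbT.
  have [xv|] := eqVneq (x p) v; last by rewrite andbT.
  rewrite andbF /= (last_occ_max ip xv) ?andbF //.
  by case/andP: ip.
split; last first.
  rewrite /potential topE.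
  have -> : count (fun p => inc p && ~~ visited st' p) (iota 0 N) =
            count (fun p => inc p && ~~ visited st p) (iota 0 N).
    by apply: eq_count => p; case ip: (inc p) => //=; rewrite visE.
  by rewrite /st' /=; lia.
split=> //.
- by case: sw => *; split.
- by move: us; rewrite stackE rcons_uniq => /andP[].
- move=> u us'; apply: stk; rewrite stackE mem_rcons inE; apply/orP; right.
  exact: us'.
- rewrite /st' /= hv => hv0.
  have [i1 i2 i3] := last_occ_inc hv0; split=> //.
  by move: us; rewrite stackE rcons_uniq => /andP[].
- move=> q hq; rewrite -[st' aCount q]/(st aCount q) cnt //; apply: eq_count => p.
  by case ip: (inc p) => //=; rewrite visE.
Qed.

Lemma scan_step st : chaining st -> st rRem 0 != 0 ->
  wp w scan_code (fun st' => chaining st' /\ potential st' < potential st) st.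
Proof.
move=> ch r0; have topn := stack_le ch.
case: ch => sw le1 e_own e_next e_head us stk cur cnt scan don.
have inx p : st Input (p + 2) = x p by rewrite (sw_input sw).
have [i0 cnt0] : inc (st rScan 0) /\ st aCount (own x (st rScan 0)) <= 1.
  by apply: scan; lia.
have lastN : st rScan 0 + (st rRem 0).-1 < N.
  have [|i1 _] := scan (st rScan 0 + (st rRem 0).-1); first by lia.
  by case/andP: i1.
set p0 := st rScan 0 in i0 cnt0 lastN *.
have xn := inc_lt i0.
rewrite /= inx -/p0; case: ifP => qx.
  rewrite /= /upd /= -/p0.
  do 2 (split; [lia | lia |]).
  set st' : store := fun _ _ => _.
  split; last first.
    by rewrite /potential -[visited st']/(visited st) /st' /=; lia.
  split=> //.
  - by case: sw => *; split.
  - by rewrite /st' /= => p pr; apply: scan; lia.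
  - rewrite /st' /= => p ip cp; have [qp|pr] := don p ip cp; first by left.
    by have [->|pp0] := eqVneq p p0; [left | right; lia].
have qx0 : st Query (x p0) = 0 by apply/eqP; rewrite -[_ == 0]negbK qx.
rewrite /= /upd /= !inx -/p0.
do 5 (split; [lia | lia |]).
set st' : store := fun _ _ => _.
have stackE : stack st' = rcons (stack st) (x p0).
  by rewrite /stack /st' /= addn1 mkseq_push.
have xs : x p0 \notin stack st.
  by apply/negP => /stk[_]; rewrite qx0.
have visE p : inc p -> visited st' p = visited st p.
  move=> ip; rewrite /visited stackE mem_rcons inE /st' /=.
  by have [->|//] := eqVneq (x p) (x p0); rewrite qx0.
have cntE q : unvisited_in st' q = unvisited_in st q.
  by apply: eq_count => p; case ip: (inc p) => //=; rewrite visE.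
have unv0 : ~~ visited st p0 by rewrite /visited qx0.
(* Two unvisited occurrences would make the counter exceed one; visited ones are
   marked, so the rule for [p0] applies. *)
have sound : S (x p0).
  apply: (S_closed i0) => p ip op pp0; apply: (sw_below sw) (inc_lt ip) _.
  suff /and3P[] : visited st p by [].
  apply/negPn/negP => unv; have [hq _ _] := incP i0.
  move: cnt0; rewrite cnt // /unvisited_in (@count_remove _ _ _ p0) ?iota_uniq //.
  - rewrite ltnS leqn0 eqn0Ngt -has_count => /hasP[]; exists p.
      by rewrite mem_iota; case/andP: ip.
    by rewrite ip op eqxx unv pp0.
  - by rewrite mem_iota; case/andP: i0.
  - by rewrite i0 eqxx unv0.
split; last first.
  rewrite /potential.
  have -> : count (fun p => inc p && ~~ visited st' p) (iota 0 N) =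
            count (fun p => inc p && ~~ visited st p) (iota 0 N).
    by apply: eq_count => p; case ip: (inc p) => //=; rewrite visE.
  rewrite (@count_remove _ (iota 0 n) (fun v => st Query v == 0) (x p0)) ?iota_uniq //;
    first 1 last.
  - by rewrite mem_iota.
  - by rewrite qx0.
  have -> : count (fun v => (st Query v == 0) && (v != x p0)) (iota 0 n) =
            count (fun v => st' Query v == 0) (iota 0 n).
    by apply: eq_count => v; rewrite /st' /=; case: (v =P x p0) => //=; rewrite ?andbT ?andbF.
  by rewrite /st' /=; lia.
split=> //.
- case: sw => s1 s2 s3 s4; split=> //= v vn; rewrite /st' /=; case: (v =P x p0) => // vE.
  + lia.
  + exact: s2.
  + exact: s3.
  + by move=> _; rewrite vE.
  + exact: s4.
- by move=> v vn; rewrite /st' /=; case: eqP => // _; apply: le1.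
- by rewrite stackE rcons_uniq xs.
- move=> v; rewrite stackE mem_rcons inE /st' /= => /orP[/eqP ->|/stk[vn qv]].
    by rewrite eqxx.
  by case: (v =P x p0).
- rewrite stackE => c0; have [ic xc qc cs] := cur c0; split=> //.
    by rewrite /st' /=; case: (_ =P x p0).
  rewrite mem_rcons inE negb_or cs andbT; apply: contraNneq qc.
  by rewrite /st' /= => ->; rewrite qx0.
- by move=> q hq; rewrite cntE -cnt.
- by rewrite /st' /= => p pr; apply: scan; lia.
- rewrite /st' /= => p ip cp.
  have [->|pp0] := eqVneq p p0; first by left; rewrite eqxx.
  have [qp|pr] := don p ip cp; last by right; lia.
  by left; case: (_ =P x p0).
Qed.

Lemma visit_step st : chaining st -> st rRem 0 = 0 -> st rCur 0 != 0 ->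
  wp w visit_code (fun st' => chaining st' /\ potential st' < potential st) st.
Proof.
move=> ch r0 c0; have topn := stack_le ch.
case: ch => sw le1 e_own e_next e_head us stk cur cnt scan don.
have inx p : st Input (p + 2) = x p by rewrite (sw_input sw).
have [ic xc qc cs] := cur c0.
move cE: (st rCur 0) c0 ic xc => c c0 ic xc.
move vE: (st rVert 0) xc qc cs => v xc qc cs.
move qE: (own x c) => q.
have [hq _ _] := incP ic; rewrite qE in hq.
rewrite /= /upd /= cE (e_own _ ic) qE (e_next _ ic) xc /=.
have cv : ~~ visited st c by rewrite /visited cE vE xc eqxx leqnn /= !andbF.
have := cnt q hq; rewrite /unvisited_in (@count_remove _ _ _ c) ?iota_uniq //; first 1 last.
- by rewrite mem_iota; case/andP: ic.
- by rewrite ic qE eqxx.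
(* [k] is the value of the counter after the decrement. *)
set k := count _ _ => cntq; rewrite cntq subn1 /=.
pose vis' p := visited st p || (p == c).
pose cnt' q' := if q' == q then k else st aCount q'.
have visE st' : st' Query =1 st Query -> st' aStack =1 st aStack ->
    st' rTop 0 = st rTop 0 -> st' rVert 0 = v -> st' rCur 0 = last_occ v c ->
    forall p, inc p -> visited st' p = vis' p.
  move=> eQ eS eT eV eC p ip; rewrite /vis' /visited /stack eQ eT eV eC cE vE.
  rewrite (eq_mkseq eS) -/(stack st).
  have [xp|] := eqVneq (x p) v; last first.
    move=> xpv; rewrite orbC; have [pc|//] := eqVneq p c.
    by rewrite pc xc eqxx in xpv.
  rewrite xp qc cs /= -ltnNge -ltnNge; apply/idP/idP => [|/orP[cp|/eqP ->]].
  - have [pc lp|//|//] := ltngtP p c.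
    by have := last_occ_max ip xp pc; lia.
  - by have := last_occ_le x N v c; lia.
  - have [->|l0] := eqVneq (last_occ v c) 0; first exact: inc_gt0 ic.
    by have [_ _] := last_occ_inc l0.
have cntE st' : st' Query =1 st Query -> st' aStack =1 st aStack ->
    st' rTop 0 = st rTop 0 -> st' rVert 0 = v -> st' rCur 0 = last_occ v c ->
    forall q', hdr q' -> unvisited_in st' q' = cnt' q'.
  move=> eQ eS eT eV eC q' hq'; rewrite /unvisited_in /cnt'.
  have vE' := visE st' eQ eS eT eV eC.
  case: eqP => [->|/eqP q'q]; last rewrite cnt //.
    apply: eq_count => p; case ip: (inc p) => //=; rewrite vE' // /vis'.
    by rewrite negb_or; case: (own x p == q).
  apply: eq_count => p; case ip: (inc p) => //=; rewrite vE' // /vis'.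
  have [->|_] := eqVneq p c; last by rewrite orbF.
  by rewrite qE eq_sym (negPf q'q).
have unvE st' : st' Query =1 st Query -> st' aStack =1 st aStack ->
    st' rTop 0 = st rTop 0 -> st' rVert 0 = v -> st' rCur 0 = last_occ v c ->
    count (fun p => inc p && ~~ visited st p) (iota 0 N) =
    (count (fun p => inc p && ~~ visited st' p) (iota 0 N)).+1.
  move=> eQ eS eT eV eC; have vE' := visE st' eQ eS eT eV eC.
  rewrite (@count_remove _ _ _ c) ?iota_uniq //; first 1 last.
  - by rewrite mem_iota; case/andP: ic.
  - by rewrite ic cv.
  congr (_.+1); apply: eq_count => p; case ip: (inc p) => //=.
  by rewrite vE' // /vis' negb_or.
have chE st' : sandwiched st' ->
    st' Query =1 st Query -> st' aStack =1 st aStack ->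
    st' rTop 0 = st rTop 0 -> st' rVert 0 = v -> st' rCur 0 = last_occ v c ->
    st' aCount =1 cnt' ->
    (forall p, inc p -> st' aOwn p = own x p) ->
    (forall p, inc p -> st' aNext p = last_occ (x p) p) ->
    (forall v, v < n -> st' aHead v = last_occ v N) ->
    (forall p, st' rScan 0 <= p < st' rScan 0 + st' rRem 0 ->
       inc p /\ cnt' (own x p) <= 1) ->
    (forall p, inc p -> cnt' (own x p) <= 1 ->
       st Query (x p) != 0 \/ st' rScan 0 <= p < st' rScan 0 + st' rRem 0) ->
    chaining st'.
  move=> sw' eQ eS eT eV eC eN eO eX eH Hs Hd.
  have sE : stack st' = stack st by rewrite /stack eT (eq_mkseq eS).
  split=> //.
  - by move=> u un; rewrite eQ le1.
  - by rewrite sE.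
  - by move=> u; rewrite sE eQ; apply: stk.
  - rewrite eC eV sE eQ => l0; have [? ? _] := last_occ_inc l0; split=> //.
  - by move=> q' hq'; rewrite eN cntE.
  - by move=> p; rewrite eN; apply: Hs.
  - by move=> p; rewrite eN eQ; apply: Hd.
have kN : k <= N by rewrite -[N](size_iota 0); apply: count_size.
have qN := header_block todoN hq; have lc := last_occ_le x N v c.
have cN : c < N by case/andP: ic.
do 3 (split; [lia | lia |]); rewrite eqxx.
have [k1|kn1] := eqVneq k 1; last first.
  set st' : store := fun b j => if (b == rCur) && (j == 0) then _ else _.
  suff ok : chaining st' /\ potential st' < potential st.
    by case: ifP => // k0; rewrite subn_eq0 -ltnNge ifT //; lia.
  split.
    apply: chE => //.
    - by case: sw => *; split.
    - by move=> p; rewrite /st' /= r0; lia.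
    - rewrite /st' /= r0 /cnt' => p ip; case: (own x p =P q) => [oq|_] kp.
        by have [||] := don p ip; rewrite ?oq ?r0 ?cntq; [lia | left | lia].
      by have [||] := don p ip; rewrite ?r0; [ | left | lia].
  rewrite /potential (unvE st') //.
  have : count (fun p => inc p && (1 < st' aCount (own x p))) (iota 0 N) <=
         count (fun p => inc p && (1 < st aCount (own x p))) (iota 0 N).
    apply: sub_count => p /andP[->] /=; rewrite /st' /=.
    by case: (own x p =P q) => // ->; rewrite cntq; lia.
  by rewrite /st' /=; lia.
have -> : k != 0 by rewrite k1.
have -> : (k - 1 != 0) = false by rewrite k1.
rewrite inx.
have xq : x q <= w by lia.
do 2 (split; [lia | lia |]); rewrite addn1.
set st' : store := fun _ _ => _.
split.
  apply: chE => //.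
  - by case: sw => *; split.
  - move=> p; rewrite /st' /= => pr.
    have [|ip op] := header_inc todoN (p := p) hq; first by lia.
    by rewrite /cnt' op eqxx k1.
  - rewrite /st' /= /cnt' => p ip; case: (own x p =P q) => [oq|_] kp.
      by have [_ o1 o2] := incP ip; rewrite oq in o1 o2; right; lia.
    by have [||] := don p ip; rewrite ?r0; [ | left | lia].
rewrite /potential (unvE st') //.
rewrite (count_split _ (fun p => inc p && (1 < st aCount (own x p)))
  (fun p => own x p == q)).
have -> : count (fun p => (inc p && (1 < st aCount (own x p))) && (own x p == q))
    (iota 0 N) = x q.
  rewrite -[RHS](count_block todoN hq); apply: eq_count => p.
  by case: (own x p =P q) => [->|]; rewrite ?andbF // cntq k1 /= !andbT.
have -> : count (fun p => (inc p && (1 < st aCount (own x p))) && (own x p != q))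
    (iota 0 N) = count (fun p => inc p && (1 < st' aCount (own x p))) (iota 0 N).
  apply: eq_count => p; rewrite /st' /=.
  by case: (own x p =P q) => _; rewrite ?andbF ?andbT // k1 andbF.
by rewrite /st' /=; lia.
Qed.

Lemma chaining0 st : pushed n st -> st rCur 0 = 0 -> st rRem 0 = 0 ->
  chaining st.
Proof.
case=> [[sw b_own b_next b_head b_cnt b_unit] le1 stackE] c0 r0.
rewrite -/(stack st) in stackE.
have unvE q : hdr q -> unvisited_in st q = x q.
  move=> hq; rewrite -(count_block todoN hq); apply: eq_count => p.
  case ip: (inc p) => //=; have xn := inc_lt ip.
  rewrite /visited stackE mem_filter mem_iota /= add0n xn andbT.
  by case: (st Query (x p) == 0); rewrite ?andbT.
split=> //.
- by move=> p ip; apply: b_own => //; case/andP: ip.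
- by move=> p ip; apply: b_next => //; case/andP: ip.
- by rewrite stackE filter_uniq ?iota_uniq.
- by move=> v; rewrite stackE mem_filter mem_iota add0n => /andP[-> /andP[]].
- by rewrite c0.
- by move=> q hq; rewrite unvE // b_cnt //; case/andP: hq.
- by move=> p; rewrite r0; lia.
- move=> p ip; have [hq o1 o2] := incP ip.
  have [pN qN] : p < N /\ own x p < N by case/andP: ip; case/andP: hq.
  by rewrite b_cnt // => cp; left; apply: b_unit => //; lia.
Qed.

(** With nothing pending, visited means marked.  If all occurrences but one in a
    hyperedge are marked, its counter is at most one, and [ch_done] gives the
    last one. *)
Lemma chaining_saturated st : chaining st ->
  st rTop 0 = 0 -> st rCur 0 = 0 -> st rRem 0 = 0 ->
  saturated (fun v => st Query v != 0).
Proof.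
move=> [_ _ _ _ _ _ _ _ cnt _ don] t0 c0 r0 p ip others.
have [//|qp] := boolP (st Query (x p) != 0).
have [hq _ _] := incP ip.
suff : st aCount (own x p) <= 1.
  by move=> /(don p ip)[|]; [rewrite (negPf qp) | rewrite r0; lia].
have vis p' : inc p' -> visited st p' = (st Query (x p') != 0).
  move=> ip'; rewrite /visited /stack t0 c0 /= leqn0.
  by rewrite [p' == 0]gtn_eqF ?(inc_gt0 ip') // andbF !andbT.
rewrite cnt // /unvisited_in (@count_remove _ _ _ p) ?iota_uniq //; first 1 last.
- by rewrite mem_iota; case/andP: ip.
- by rewrite ip eqxx vis.
rewrite ltnS leqn0 eqn0Ngt -has_count; apply/hasPn => p' _.
apply/negP => /andP[/and3P[ip' /eqP op' vp'] pp'].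
by move: vp'; rewrite vis // others.
Qed.

Lemma chain_runs st : pushed n st ->
  runs call w chain_code st ((cost chain_body + 20) * (2 * (n + N)).+1) 0
    (fun st' => [/\ sandwiched st', forall v, v < n -> st' Query v <= 1
      & saturated (fun v => st' Query v != 0)]).
Proof.
move=> ps.
pose J k st := chaining st /\ k = potential st.
have step k st0 : J k st0 ->
    eval st0 (Add (reg rTop) (Add (reg rCur) (reg rRem))) != 0 ->
    runs call w chain_body st0 (cost chain_body) 0
      (fun st' => exists2 k', k' < k & J k' st').
  case=> ch -> guard; apply: (@runs_conseq _ _ _ _ (cost chain_body) 0
    (fun st' => chaining st' /\ potential st' < potential st0)) => //.
    by move=> st' [ch' lt]; exists (potential st').
  apply: runs_wp; rewrite /chain_body wp_if [eval _ _]/=.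
  have [r0|r0] := eqVneq (st0 rRem 0) 0; last exact: scan_step.
  rewrite wp_if [eval _ _]/=; have [c0|c0] := eqVneq (st0 rCur 0) 0; last exact: visit_step.
  by apply: pop_step => //; move: guard; rewrite /= c0 r0 !addn0.
have start : runs call w chain_init st 6 0
    (fun st' => exists2 k, k <= 2 * (n + N) & J k st').
  apply: runs_wp; rewrite /= /upd /=.
  do 2 (split=> //); set st' : store := fun _ _ => _.
  have ch : chaining st'.
    apply: chaining0 => //; case: ps => [[sw b1 b2 b3 b4 b5] p1 p2].
    by split=> //; split=> //; case: sw => *; split.
  exists (potential st') => //; have := stack_le ch.
  rewrite /potential => topn.
  have c1 a : count a (iota 0 N) <= N by rewrite -{2}(size_iota 0 N) count_size.
  have c2 a : count a (iota 0 n) <= n by rewrite -{2}(size_iota 0 n) count_size.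
  have := c1 (fun p => inc p && ~~ visited st' p).
  have := c1 (fun p => inc p && (1 < st' aCount (own x p))).
  have := c2 (fun v => st' Query v == 0).
  have -> : st' rRem 0 = 0 by [].
  lia.
have loop k st0 (J0 : J k st0) := runs_while step J0.
apply: (@runs_conseq _ _ _ _ (6 +
  ((9 + cost chain_body) * (2 * (n + N)) + 9)) (0 + 0)) => //.
- by rewrite mulnS; nia.
- by move=> st'; exact.
apply: runs_seq; apply: runs_conseq start => // st0 [k kle J0].
apply: runs_conseq (loop k st0 J0) => //.
  by rewrite leq_add2r leq_mul2l kle orbT.
move=> st' [[k' [ch _]] /eqP] /=; rewrite !addn_eq0 => /and3P[/eqP t0 /eqP c0 /eqP r0].
by split; [case: ch | case: ch | apply: chaining_saturated].
Qed.

Lemma forward_chaining_runs st : st Input =1 word -> st Query =1 Q0 ->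
  runs call w forward_chaining st (1000 * (n + N).+1) 0
    (fun st' => [/\ sandwiched st', forall v, v < n -> st' Query v <= 1
      & saturated (fun v => st' Query v != 0)]).
Proof.
move=> st_in st_q.
apply: (@runs_conseq _ _ _ _ (30 * n.+1 + ((cost build_body + 30) * N.+1 +
  (60 * n.+1 + (cost chain_body + 20) * (2 * (n + N)).+1))) (0 + (0 + (0 + 0)))) => //.
- by rewrite [cost build_body]/= [cost chain_body]/=; lia.
- by move=> st'; exact.
apply: runs_seq; apply: runs_conseq (clear_runs st_in st_q) => // st1 [sw heads0].
apply: runs_seq; apply: runs_conseq (build_runs sw heads0) => // st2 bt.
apply: runs_seq; apply: runs_conseq (push_runs bt) => // st3 ps.
exact: chain_runs.
Qed.

End Correctness.

(** * Hyperedges in the input *)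

Section Encoding.

Variables (V : finType) (H : seq (seq V)).

Definition ranks (A : seq V) : seq nat := [seq val (enum_rank v) | v <- A].

Lemma nth_ranks A j : j < size A ->
  exists2 u, u \in A & nth 0 (ranks A) j = enum_rank u /\ nth u A j = u.
Proof.
case: A => // u0 A jA; exists (nth u0 (u0 :: A) j); first exact: mem_nth.
by rewrite (nth_map u0) //; split=> //; apply: set_nth_default.
Qed.

Lemma nth_ranks_index A v : v \in A ->
  nth 0 (ranks A) (index v A) = enum_rank v.
Proof. by move=> vA; rewrite (nth_map v) ?index_mem // nth_index. Qed.

Definition blocks : seq (seq nat) := [seq size A :: ranks A | A <- H].
Let word : nat -> nat := nth 0 (encode H).
Let x p := word (p + 2).
Let N := size (flatten blocks).
Let edge k := nth [::] H k.
Definition offset k : nat := size (flatten (take k blocks)).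

Lemma wordE p : x p = nth 0 (flatten blocks) p.
Proof. by rewrite /x /word addn2. Qed.

Lemma size_blocks : size blocks = size H.
Proof. exact: size_map. Qed.

Lemma blockE k : k < size H -> nth [::] blocks k = size (edge k) :: ranks (edge k).
Proof. by move=> kH; rewrite (nth_map [::]). Qed.

Lemma offsetS k : k < size H -> offset k.+1 = (offset k).+1 + size (edge k).
Proof.
move=> kH; rewrite /offset (take_nth [::]) ?size_blocks // flatten_rcons.
by rewrite size_cat blockE //= size_map addSnnS.
Qed.

Lemma offset_size : offset (size H) = N.
Proof. by rewrite /offset -size_blocks take_size. Qed.

Lemma word_block k i : k < size H -> i <= size (edge k) ->
  x (offset k + i) = nth 0 (size (edge k) :: ranks (edge k)) i.
Proof.
move=> kH iA; rewrite wordE -[blocks in LHS](cat_take_drop k) flatten_cat nth_cat.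
rewrite ltnNge leq_addr /= addKn (drop_nth [::]) ?size_blocks //= nth_cat.
by rewrite blockE //= size_map ltnS iA.
Qed.

(** On an encoded hypergraph the headers found by the parser are exactly the
    block boundaries. *)
Lemma parse_offset k : k <= size H ->
  [/\ todo x (offset k) = 0, heads x (offset k) = k
    & forall q, q < offset k -> todo x q = 0 -> exists2 j, j < k & q = offset j].
Proof.
elim: k => [|k IH] kH; first by rewrite /offset take0.
have [t0 hk onto] := IH (ltnW kH).
have xk : x (offset k) = size (edge k) by rewrite -[offset k]addn0 word_block.
have blk i := @parse_block x (offset k) i t0.
rewrite xk in blk; rewrite offsetS //; split.
- by have [-> _ _] := blk _ (leqnn _); rewrite subnn.
- by have [_ _ ->] := blk _ (leqnn _); rewrite hk.
- move=> q qk tq; have [qo|oq|->] := ltngtP q (offset k); last by exists k.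
    by have [j jk ->] := onto q qo tq; exists j => //; apply: leqW.
  have [|t _ _] := blk (q - (offset k).+1); first by lia.
  by move: t; rewrite subnKC // tq; lia.
Qed.

Lemma todo_size : todo x N = 0.
Proof. by rewrite -offset_size; have [] := parse_offset (leqnn _). Qed.

Lemma heads_size : heads x N = word 1.
Proof. by rewrite -offset_size; have [_ ->] := parse_offset (leqnn _). Qed.

Lemma own_edge p k : k < size H -> incidence x N p -> own x p = offset k ->
  exists i, [/\ i < size (edge k), p = (offset k).+1 + i
    & x p = nth 0 (ranks (edge k)) i].
Proof.
move=> kH ip ok; have [_ op pb] := incP ip.
have xk : x (offset k) = size (edge k) by rewrite -[offset k]addn0 word_block.
rewrite ok xk in op pb; exists (p - (offset k).+1).
have pE : p = (offset k).+1 + (p - (offset k).+1) by lia.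
split=> //; first lia.
by rewrite {1}pE addSnnS word_block //; lia.
Qed.

Lemma inc_edge p : incidence x N p -> exists2 k, k < size H & own x p = offset k.
Proof.
move=> ip; have [/andP[oN /eqP o0] _ _] := incP ip.
have [_ _ onto] := parse_offset (leqnn (size H)).
by rewrite offset_size in onto; apply: onto.
Qed.

Lemma edge_inc k i : k < size H -> i < size (edge k) ->
  [/\ incidence x N ((offset k).+1 + i), own x ((offset k).+1 + i) = offset k
    & x ((offset k).+1 + i) = nth 0 (ranks (edge k)) i].
Proof.
move=> kH iA; have [t0 _ _] := parse_offset (ltnW kH).
have xk : x (offset k) = size (edge k) by rewrite -[offset k]addn0 word_block.
have [|t o _] := @parse_block x (offset k) i t0; first by rewrite xk ltnW.
have : (offset k).+1 + size (edge k) <= N.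
  rewrite -offsetS // /offset /N.
  rewrite -[X in _ <= size (flatten X)](cat_take_drop k.+1).
  by rewrite flatten_cat size_cat leq_addr.
move=> kN; rewrite /incidence t xk; split=> //; first by lia.
by rewrite addSnnS word_block.
Qed.

Lemma incidence_lt p : incidence x N p -> x p < word 0.
Proof.
move=> ip; have [k kH ok] := inc_edge ip.
have [i [iA _ ->]] := own_edge kH ip ok; by have [u _ [-> _]] := nth_ranks iA; apply: ltn_ord.
Qed.

Definition ranked (M : {set V}) (i : nat) : Prop :=
  exists2 v, v \in M & i = enum_rank v.

Lemma ranked_rank M v : ranked M (enum_rank v) <-> v \in M.
Proof.
split=> [[u uM /val_inj/enum_rank_inj -> //]|vM]; by exists v.
Qed.

Lemma mem_edge k : k < size H -> edge k \in H.
Proof. exact: mem_nth. Qed.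

Lemma ModP (M : {set V}) : reflect
  (forall A v, A \in H -> v \in A ->
     (forall u, u \in A -> u != v -> u \in M) -> v \in M)
  (M \in Mod (Phi (edges H))).
Proof.
apply: (iffP idP) => [|clM].
  rewrite inE => /forall_inP ok A v AH vA others.
  have /ok : ([set v in A] :\ v, v) \in Phi (edges H).
    apply/imset2P; exists [set v in A] v; rewrite ?inE //.
    by apply/mapP; exists A.
  move=> /implyP; apply; apply/subsetP => u.
  by rewrite !inE => /andP[uv uA]; apply: others.
rewrite inE; apply/forall_inP => c /imset2P[B v].
rewrite inE => /mapP[A AH ->]; rewrite inE => vA -> /=.
apply/implyP => /subsetP sub; apply: clM AH vA _ => u uA uv.
by apply: sub; rewrite !inE uv.
Qed.

Lemma Mod_closed (M : {set V}) : M \in Mod (Phi (edges H)) -> saturated word N (ranked M).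
Proof.
move=> /ModP MM p ip others; have [k kH ok] := inc_edge ip.
have [i [iA _ xp]] := own_edge kH ip ok.
have [v vA [vE _]] := nth_ranks iA.
rewrite -/(x p) xp vE; apply/ranked_rank.
apply: MM (mem_edge kH) vA _ => u uA uv; apply/ranked_rank.
have [ip' op' xp'] := edge_inc kH (etrans (index_mem u _) uA).
rewrite -(nth_ranks_index uA) -xp'; apply: others => //; first by rewrite op'.
apply: contraNneq uv => pp'; apply/eqP/enum_rank_inj/val_inj => /=.
by rewrite -(nth_ranks_index uA) -xp' pp' xp.
Qed.

(** Lists without repetition are needed here: if a vertex occurred twice in a
    hyperedge, the other occurrence would block the rule for the first one. *)
Lemma closed_Mod (M : {set V}) : all uniq H -> saturated word N (ranked M) ->
  M \in Mod (Phi (edges H)).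
Proof.
move=> /allP uH cl; apply/ModP => A v AH vA others.
have [k kH AE] : exists2 k, k < size H & A = edge k.
  by exists (index A H); rewrite ?index_mem // /edge nth_index.
rewrite AE in AH vA others.
have iA : index v (edge k) < size (edge k) by rewrite index_mem.
have [ip op xp] := edge_inc kH iA.
apply/ranked_rank; rewrite -(nth_ranks_index vA) -xp; apply: cl ip _ => p' ip' op' pp'.
rewrite op in op'; have [i [iA' pE xp']] := own_edge kH ip' op'.
rewrite -/(x p') xp'.
have [u uA [-> ui]] := nth_ranks iA'; apply/ranked_rank; apply: others => //.
apply: contraNneq pp' => uv; rewrite pE -uv.
suff -> : i = index u (edge k) by [].
by rewrite -[in index _ _]ui index_uniq //; apply: uH.
Qed.

End Encoding.

(** * Correctness of the closure procedure *)

Section ClosureOperator.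

Variables (V : finType) (H : seq (seq V)).
Local Notation E := (edges H).

Lemma cl_Mod (Y : {set V}) : cl E Y \in Mod (Phi E).
Proof.
apply/ModP => A v AH vA others; apply/bigcapP => M /andP[MM YM].
move/ModP: (MM) => /(_ A v AH vA); apply=> u uA uv.
by have /bigcapP/(_ M) := others u uA uv; apply; rewrite MM.
Qed.

Lemma sub_cl (Y : {set V}) : Y \subset cl E Y.
Proof. by apply/bigcapsP => M /andP[]. Qed.

Lemma cl_min (Y M : {set V}) : M \in Mod (Phi E) -> Y \subset M -> cl E Y \subset M.
Proof. by move=> MM YM; apply: bigcap_inf; rewrite MM. Qed.

Lemma clS (X Y : {set V}) : X \subset Y -> cl E X \subset cl E Y.
Proof.
by move=> XY; apply: cl_min (cl_Mod Y) _; apply: subset_trans XY (sub_cl Y).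
Qed.

(** The interface between the main program and closure calls, met both by the
    oracle and by the procedure. *)
Definition closure_spec call w T : Prop :=
  forall st, st Input =1 init H Input ->
  runs call w Closure st T 1 (fun st' =>
    [/\ st' Query =1 close_query H st Query, st' Input =1 st Input
      & forall k, st' (Main k) =1 st (Main k)]).

Lemma close_query_rank st v :
  close_query H st Query (enum_rank v) = (v \in cl E (Defs.set_of V st Query)).
Proof. by rewrite /close_query valK enum_rankK. Qed.

Lemma close_query_out st a i : #|V| <= i -> close_query H st a i = st a i.
Proof. by move=> ni; rewrite /close_query insubF ?ltnNge ?ni //; case: a. Qed.

Lemma oracle_spec w : closure_spec (oracle_call H) w 1.
Proof.
move=> st _; exists [:: EClosure], (close_query H st); split=> //.
exact: ExecClosure.
Qed.

End ClosureOperator.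

Lemma exec_frame (c : cmd) (rd wr : pred arr) a st tr st' :
  exec (fun _ _ _ => False) c st tr st' -> scoped rd wr false c -> ~~ wr a ->
  st' a =1 st a.
Proof.
move=> run sc wa; elim: run sc => //=.
- move=> b e1 e2 st0 /and3P[wb _ _] i; rewrite /upd.
  by case: eqP => // ab; rewrite ab wb in wa.
- by move=> c1 c2 st0 tr1 st1 tr2 st2 _ IH1 _ IH2 /andP[/IH1 e1 /IH2 e2] i; rewrite e2.
- by move=> e c1 c2 st0 tr0 st1 _ IH /and3P[_ s1 s2]; apply: IH; case: ifP.
- move=> e c0 st0 tr1 st1 tr2 st2 _ _ IH1 _ IH2 /[dup] /IH2 e2 /andP[_ /IH1 e1] i.
  by rewrite e2.
Qed.

Lemma rankP (V : finType) (i : nat) : i < #|V| -> exists v : V, i = enum_rank v.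
Proof. by move=> iV; exists (enum_val (Ordinal iV)); rewrite enum_valK. Qed.

Lemma forward_chaining_scoped : closure_procedure forward_chaining.
Proof. by []. Qed.

Section Procedure.

Variables (V : finType) (H : seq (seq V)).
Hypothesis H_uniq : all uniq H.
Let n := #|V|.
Let N := size (flatten (blocks H)).

Lemma procedure_spec w : n + N < w ->
  closure_spec H (procedure_call H forward_chaining) w (1000 * (n + N).+1).+1.
Proof.
move=> w_ge st st_in; set X := cl (edges H) (Defs.set_of V st Query).
have S_Q0 v : v < nth 0 (encode H) 0 -> st Query v != 0 -> ranked X v.
  move=> /rankP[u ->] qu; apply/ranked_rank/(subsetP (sub_cl H _)).
  by rewrite inE.
have X_sat := Mod_closed (cl_Mod H (Defs.set_of V st Query)).
have [tr [st' [run tr_t tr_k tr_w [sw le1 sat]]]] :=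
  @forward_chaining_runs (fun _ _ _ => False) w _ _ (todo_size H) (heads_size H)
    (@incidence_lt _ H) w_ge _ _ X_sat S_Q0 st st_in (frefl _).
have mE : Defs.set_of V st' Query = X.
  apply/eqP; rewrite eqEsubset; apply/andP; split.
    apply/subsetP => v; rewrite inE => qv; apply/ranked_rank.
    exact: (sw_below sw) (ltn_ord _) qv.
  apply: cl_min; last first.
    by apply/subsetP => v; rewrite !inE; apply: (sw_above sw); apply: ltn_ord.
  apply: closed_Mod => // p ip others.
  have xn := incidence_lt ip; have [v xv] := rankP xn.
  rewrite xv; apply/ranked_rank; rewrite inE -xv; apply: sat ip _ => p' ip' op' pp'.
  have [v' v'M ->] := others p' ip' op' pp'.
  by rewrite inE in v'M.
have qE : st' Query =1 close_query H st Query.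
  move=> i; have [iV|Vi] := ltnP i #|V|; last first.
    by rewrite close_query_out // (sw_outside sw).
  have [v ->] := rankP iV; rewrite close_query_rank -/X -mE inE.
  by have := le1 _ (ltn_ord (enum_rank v)); case: (st' Query _) => [|[]].
exists (EClosure :: tr), st'; split=> //.
- by apply: ExecClosure; exists tr.
split=> //.
- by apply: (exec_frame run forward_chaining_scoped).
- by move=> k; apply: (exec_frame run forward_chaining_scoped).
Qed.

End Procedure.

(** * The greedy search for a coatom *)

Notation aBest := (Main 2).
Notation rFound := (Main 1).
Notation rStep := (Main 3).
Notation rIndex := (Main 4).
Notation rFull := (Main 5).

Definition main_vertices : expr := Read (Main 0) (Cst 0).

Definition copy (dst src : arr) : cmd :=
  For rIndex main_vertices (Assign dst (reg rIndex) (Read src (reg rIndex))).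

Definition test_full : cmd :=
  set_reg rFull (Cst 1) ;;
  For rIndex main_vertices
    (If (Read Query (reg rIndex)) Skip (set_reg rFull (Cst 0))).

Definition insert_vertex : cmd :=
  If (reg rStep) (Assign Query (Minus (reg rStep) (Cst 1)) (Cst 1)) Skip.

Definition try_step : cmd :=
  copy Query aBest ;; insert_vertex ;; Closure ;; test_full ;;
  If (reg rFull) Skip (set_reg rFound (Cst 1) ;; copy aBest Query).

(** In round [0] no vertex is inserted, in round [j.+1] the vertex of number [j].
    All rounds run the same code, so a vertex already in the candidate is tried
    too; this changes nothing. *)
Definition greedy : cmd := For rStep (Add main_vertices (Cst 1)) try_step.

Section Fragments.

Variables (call : store -> seq event -> store -> Prop) (w n : nat).

Lemma copy_runs dst src st : n <= w ->
  dst != src -> dst != rIndex -> src != rIndex -> dst != Main 0 ->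
  st (Main 0) 0 = n -> (forall i, i < n -> st src i <= w) ->
  runs call w (copy dst src) st (30 * n.+1) 0 (fun st' =>
    (forall a, a != dst -> a != rIndex -> st' a =1 st a) /\
    forall i, i < n -> st' dst i = st src i).
Proof.
move=> nw ds di si d0 n0 srcw.
pose I i st' := (forall a, a != dst -> a != rIndex -> st' a =1 st a) /\
  forall k, k < i -> st' dst k = st src k.
have step i st' : i < n -> st' rIndex 0 = i -> I i st' ->
    runs call w (Assign dst (reg rIndex) (Read src (reg rIndex))) st' 6 0
      (fun st'' => I i.+1 st'' /\ st'' rIndex 0 = i).
  move=> lt_in ri [I1 I2]; apply: runs_wp; rewrite /= ri.
  have -> : st' src i = st src i by rewrite I1 // eq_sym.
  split; [lia | exact: srcw |]; split; last first.
    by rewrite /upd eq_sym (negPf di).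
  split=> [a ad ai j|k ki]; rewrite /upd ?(negPf ad) ?eqxx /=; first exact: I1.
  by case: (k =P i) => [-> //|ki']; apply: I2; lia.
apply: runs_conseq (runs_for nw _ _ step _) => //=; [lia | |].
- move=> i st' y [I1 I2]; split=> [a ad ai j|k ki]; rewrite /upd.
    by rewrite (negPf ai); apply: I1.
  by rewrite (negPf di); apply: I2.
- by move=> i st' [I1 _]; rewrite I1 // eq_sym.
Qed.

Lemma test_runs st : n <= w -> 0 < w -> st (Main 0) 0 = n ->
  runs call w test_full st (40 * n.+1) 0 (fun st' =>
    (forall a, a != rFull -> a != rIndex -> st' a =1 st a) /\
    (st' rFull 0 != 0) = all (fun i => st Query i != 0) (iota 0 n)).
Proof.
move=> nw w0 n0.
pose I i st' := (forall a, a != rFull -> a != rIndex -> st' a =1 st a) /\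
  (st' rFull 0 != 0) = all (fun k => st Query k != 0) (iota 0 i).
have step i st' : i < n -> st' rIndex 0 = i -> I i st' ->
    runs call w (If (Read Query (reg rIndex)) Skip (set_reg rFull (Cst 0))) st' 8 0
      (fun st'' => I i.+1 st'' /\ st'' rIndex 0 = i).
  move=> lt_in ri [I1 I2]; apply: runs_wp; rewrite /= ri I1 //.
  rewrite /I iota_rcons all_rcons; case: ifP => qi /=; first by rewrite qi.
  rewrite qi; split=> //; split=> //; split=> //.
  by move=> a af ai j; rewrite /upd (negPf af); apply: I1.
have start : runs call w (set_reg rFull (Cst 1)) st 3 0 (I 0).
  apply: runs_wp; split=> //; split=> // a af ai j.
  by rewrite /upd (negPf af).
apply: (@runs_conseq _ _ _ _ (3 + 30 * n.+1) (0 + 0 * n)) => //; first lia.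
  by move=> st'; exact.
apply: runs_seq; apply: runs_conseq start => // st1 I01.
apply: runs_conseq (runs_for nw _ _ step I01) => //=.
- move=> i st' y [I1 I2]; split=> [a ad ai j|]; rewrite /upd //.
  by rewrite (negPf ai); apply: I1.
- by move=> i st' [I1 _]; rewrite I1.
Qed.

End Fragments.

Section Greedy.

Variables (V : finType) (H : seq (seq V)).
Local Notation E := (edges H).
Local Notation n := #|V|.

Definition with_vertex (j : nat) (Y : {set V}) : {set V} :=
  [set v | (v \in Y) || ((enum_rank v).+1 == j)].

(** The state of the search before round [j], when the vertices of number less
    than [j.-1] have been tried. *)
Definition progress (j : nat) (found : bool) (Y : {set V}) : Prop :=
  if found then
    [/\ Y \in Mod (Phi E), Y != [set: V]
      & forall v, enum_rank v < j.-1 -> v \notin Y -> cl E (v |: Y) = [set: V]]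
  else Y = set0 /\ (j = 0 \/ cl E set0 = [set: V]).

(** A vertex rejected with a smaller candidate stays rejected because closure is
    monotone.  If nothing has been accepted in round [0], the closure of the
    empty set is everything and nothing is accepted later. *)
Lemma progress_step j found Y : progress j found Y ->
  let Z := cl E (with_vertex j Y) in
  if Z == [set: V] then progress j.+1 found Y else progress j.+1 true Z.
Proof.
set X := with_vertex j Y => + Z.
have YX : Y \subset X by apply/subsetP => v vY; rewrite inE vY.
have XZ : X \subset Z := sub_cl H X.
case: found => [[YM YT Ymax]|[Y0 j0]]; case: eqP => [ZT|/eqP ZT].
- split=> // v /=; rewrite leq_eqVlt => vj vY.
  have [vj1|] := boolP (enum_rank v < j.-1); first exact: Ymax.
  move=> nvj; apply/eqP; rewrite -subTset -ZT; apply: clS.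
  apply/subsetP => u; rewrite !inE => /orP[->|uj]; first by rewrite orbT.
  suff -> : u = v by rewrite eqxx.
  apply/enum_rank_inj/val_inj => /=; move: vj nvj uj.
  by move: (_ (enum_rank u)) (_ (enum_rank v)) => a b; lia.
- split=> // [|v /= vj vZ]; first exact: cl_Mod.
  have vY : v \notin Y by apply: contra vZ => /(subsetP YX)/(subsetP XZ).
  have vX : v \notin X by apply: contra vZ => /(subsetP XZ).
  have vj1 : enum_rank v < j.-1.
    by move: vX; rewrite inE (negPf vY) /=; lia.
  apply/eqP; rewrite -subTset -(Ymax v vj1 vY); apply: clS.
  by rewrite setUS // (subset_trans YX).
- split=> //; right; case: j0 => // j0; rewrite -ZT; congr (cl E _).
  by apply/setP => v; rewrite !inE Y0 j0 inE.
- case: j0 => [j0|clT].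
    by split=> //; [exact: cl_Mod | move=> v; rewrite j0].
  by case/negP: ZT; rewrite -subTset -clT clS // sub0set.
Qed.

Lemma progress_correct found Y : progress n.+1 found Y ->
  correct H (if found then Some Y else None).
Proof.
case: found => [[YM YT Ymax]|[_ [//|clT]] M] /=.
  apply/maxsetP; split=> [|X /andP[XM XT] YX]; first by rewrite YM.
  apply/eqP; rewrite eqEsubset YX andbT; apply/subsetP => v vX.
  apply/negPn/negP => vY; case/negP: XT.
  rewrite -subTset -(Ymax v (ltn_ord _) vY); apply: cl_min => //.
  by rewrite subUset sub1set vX.
apply/negP => /maxsetp/andP[MM /negP[]].
by rewrite -subTset -clT; apply: cl_min; rewrite ?sub0set.
Qed.

Variables (call : store -> seq event -> store -> Prop) (w T : nat).
Hypothesis call_spec : closure_spec H call w T.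
Hypothesis n_lt_w : n < w.

Record greedy_inv (j : nat) (st : store) : Prop := {
  gr_input : st Input =1 init H Input;
  gr_size : st (Main 0) 0 = n;
  gr_best : forall i, i < n -> st aBest i <= 1;
  gr_progress : progress j (st rFound 0 != 0) (Defs.set_of V st aBest) }.

Lemma eq_set_of st a st' a' : (forall i, i < n -> st a i = st' a' i) ->
  Defs.set_of V st a = Defs.set_of V st' a'.
Proof. by move=> eqa; apply/setP => v; rewrite !inE eqa. Qed.

Lemma insert_runs j st Y : j <= n -> st rStep 0 = j ->
  Defs.set_of V st Query = Y ->
  runs call w insert_vertex st 12 0 (fun st' =>
    (forall a, a != Query -> st' a =1 st a) /\
    Defs.set_of V st' Query = with_vertex j Y).
Proof.
move=> jn rj qY; apply: (@runs_conseq _ _ _ _ (cost insert_vertex) 0) => //.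
  by move=> st'; exact.
apply: runs_wp; rewrite /= rj; case: eqP => [->|/eqP j0] /=.
  split=> //; apply/setP => v; rewrite -qY !inE; by rewrite orbF.
split; [lia | lia |]; split=> [a aq i|]; first by rewrite /upd (negPf aq).
apply/setP => v; rewrite -qY !inE /upd /=; move: (nat_of_ord _) => r.
by case: (r =P j - 1) => ?; case: (r.+1 =P j) => ?; rewrite ?orbT ?orbF //; lia.
Qed.

Lemma try_step_runs j st : j <= n -> st rStep 0 = j -> greedy_inv j st ->
  runs call w try_step st (T + 120 * n.+1) 1 (fun st' =>
    greedy_inv j.+1 st' /\ st' rStep 0 = j).
Proof.
move=> jn rj [g_in g_n g_le g_pr].
have nw : n <= w by lia.
apply: (@runs_conseq _ _ _ _ (30 * n.+1 + (12 + (T + (40 * n.+1 +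
  (3 + (3 + 30 * n.+1)))))) (0 + (0 + (1 + (0 + 0))))) => //; first lia.
  by move=> st'; exact.
apply: runs_seq.
have best_w i : i < n -> st aBest i <= w by move/g_le; lia.
apply: runs_conseq (@copy_runs call w n Query aBest st nw isT isT isT isT g_n best_w) => //.
move=> st1 [f1 q1]; apply: runs_seq.
have rj1 : st1 rStep 0 = j by rewrite f1.
have q1E := @eq_set_of st1 Query st aBest q1.
apply: runs_conseq (insert_runs jn rj1 q1E) => // st2 [f2 q2].
have f12 a : a != Query -> a != rIndex -> st2 a =1 st a.
  by move=> aq ai i; rewrite f2 // f1.
apply: runs_seq.
have in2 : st2 Input =1 init H Input by move=> i; rewrite f12.
apply: runs_conseq (call_spec in2) => // st3 [q3 in3 f3].
set Z := cl E (with_vertex j (Defs.set_of V st aBest)).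
have q3E v : st3 Query (enum_rank v) = (v \in Z) by rewrite q3 close_query_rank q2.
have n3 : st3 (Main 0) 0 = n by rewrite f3 f12.
apply: runs_seq; have w0 : 0 < w by lia.
apply: runs_conseq (test_runs call nw w0 n3) => // st4 [f4 full4].
have fullE : (st4 rFull 0 != 0) = (Z == [set: V]).
  rewrite full4 -subTset; apply/allP/subsetP => [full v _|full i].
    have := full (enum_rank v); rewrite mem_iota add0n ltn_ord q3E => /(_ isT).
    by case: (v \in Z).
  rewrite mem_iota add0n => /= /rankP[v ->]; rewrite q3E full //.
have q4E v : st4 Query (enum_rank v) = (v \in Z) by rewrite f4.
have f34 k : Main k != rFull -> Main k != rIndex -> st4 (Main k) =1 st (Main k).
  by move=> kf ki i; rewrite f4 // f3 f12.
have in4 : st4 Input =1 init H Input by move=> i; rewrite f4 // in3.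
have := progress_step g_pr; cbv zeta; rewrite -/Z -fullE => next.
apply: runs_if; rewrite [eval _ _]/=; case: ifP next => full next.
  apply: (@runs_conseq _ _ _ _ 1 0 (fun st' => st' = st4)) => //; last exact: runs_wp.
  move=> _ ->; split; last by rewrite f34.
  split=> //; [by rewrite f34 | by move=> i iN; rewrite f34 // g_le |].
  rewrite (@eq_set_of st4 aBest st aBest) => [|i _]; last by rewrite f34.
  by rewrite f34.
apply: (@runs_seq _ _ _ _ _ 3 0 _ 0).
apply: (@runs_conseq _ _ _ _ 3 0 (fun st' => st' = upd st4 rFound 0 1)) => //;
  last exact: runs_wp.
move=> _ ->; set st5 := upd _ _ _ _.
have n5 : st5 (Main 0) 0 = n by rewrite /st5 /upd /= f34.
have q5 i : i < n -> st5 Query i <= 1.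
  by move=> /rankP[v ->]; rewrite /st5 /upd /= q4E leq_b1.
have q5w i : i < n -> st5 Query i <= w by move=> /q5; lia.
apply: runs_conseq (@copy_runs call w n aBest Query st5 nw isT isT isT isT n5 q5w) => //.
move=> st6 [f6 b6]; split; last by rewrite f6 // /st5 /upd /= f34.
split.
- by move=> i; rewrite f6 // /st5 /upd /= in4.
- by rewrite f6 // n5.
- by move=> i iN; rewrite b6 // q5.
- have -> : Defs.set_of V st6 aBest = Z.
    by apply/setP => v; rewrite inE b6 // /st5 /upd /= q4E eqb0 negbK.
  by rewrite f6 // /st5 upd_same.
Qed.

Lemma greedy_runs :
  runs call w greedy (init H) ((T + 150 * n.+1) * n.+2) n.+1
    (fun st => correct H (answer V st)).
Proof.
have step j st : j < n.+1 -> st rStep 0 = j -> greedy_inv j st ->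
    runs call w try_step st (T + 120 * n.+1) 1 (fun st' =>
    greedy_inv j.+1 st' /\ st' rStep 0 = j).
  by rewrite ltnS; apply: try_step_runs.
apply: runs_conseq (runs_for n_lt_w _ _ step _) => //=.
- by rewrite leq_mul2r; apply/orP; right; lia.
- by rewrite mul1n.
- move=> st [_ _ _ /progress_correct].
  by rewrite /answer; case: (st rFound 0 != 0).
- by move=> j st y [g1 g2 g3 g4]; split.
- by move=> j st [_ -> _ _]; rewrite addn1.
- split=> //=; split; last by left.
  by apply/setP => v; rewrite !inE.
Qed.

End Greedy.

(** * Space and size of the input *)

Definition writes_in (wr : pred arr) (tr : seq event) : bool :=
  all (fun ev => if ev is EWrite a _ _ then wr a else true) tr.

Lemma exec_writes call (wr : pred arr) c st tr st' :
  (forall st0 tr0 st1, call st0 tr0 st1 -> writes_in wr tr0) ->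
  exec call c st tr st' -> scoped predT wr true c -> writes_in wr tr.
Proof.
move=> call_wr run; have ops j tr0 : writes_in wr (nseq j EOp ++ tr0) = writes_in wr tr0.
  by rewrite /writes_in all_cat all_nseq orbT.
have cat tr1 tr2 : writes_in wr (tr1 ++ tr2) = writes_in wr tr1 && writes_in wr tr2.
  exact: all_cat.
elim: run => //=.
- by move=> a e1 e2 st0; rewrite ops /= => /and3P[->].
- move=> c1 c2 st0 tr1 st1 tr2 st2 _ IH1 _ IH2; rewrite cat.
  by move=> /andP[/IH1 -> /IH2].
- move=> e c1 c2 st0 tr0 st1 _ IH /and3P[_ s1 s2]; rewrite [writes_in _ _](ops (esize e).+1).
  by apply: IH; case: ifP.
- by move=> e c0 st0 _ _; rewrite /writes_in /= all_nseq orbT.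
- move=> e c0 st0 tr1 st1 tr2 st2 _ _ IH1 _ IH2; rewrite [writes_in _ _](ops (esize e).+1) cat.
  by move=> /[dup] /IH2 -> /andP[_ /IH1 ->].
- by move=> st0 tr0 st1 /call_wr.
Qed.

Lemma space_le (arrs : seq arr) w tr :
  writes_in (mem arrs) tr -> words_bounded w tr ->
  space tr <= size arrs * w.+1.
Proof.
move=> tr_in tr_w.
rewrite -(size_iota 0 w.+1) -(size_allpairs (fun a i => (a, i))).
apply: uniq_leq_size (undup_uniq _) _ => -[a i]; rewrite mem_undup.
have : forall b j, b \in arrs -> j <= w ->
    (b, j) \in [seq (b, j) | b <- arrs, j <- iota 0 w.+1].
  by move=> b j ba jw; apply: allpairs_f; rewrite ?mem_iota.
move: (flatten _) => cells in_cells.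
elim: tr tr_in tr_w => // -[|b j y|] tr IH /=; [exact: IH | | exact: IH].
move=> /andP[ba tr_in] /andP[/andP[jw _] tr_w].
by rewrite inE => /orP[/eqP[-> ->]|]; [apply: in_cells | apply: IH].
Qed.

Lemma size_blocks_sum (V : finType) (H : seq (seq V)) :
  size (flatten (blocks H)) = size H + \sum_(A <- H) size A.
Proof.
elim: H => [|A H IH]; first by rewrite big_nil.
by rewrite big_cons /= size_cat IH size_map addSn addnCA.
Qed.

Section Normalized.

Variables (V : finType) (H : seq (seq V)).
Hypothesis H_norm : normalized H.

Lemma normalized_L : L H = #|V| + size (flatten (blocks H)).
Proof.
case/and3P: H_norm => /allP H_uniq edges_uniq _.
rewrite /L -addnA; congr (_ + _).
have -> : #|edges H| = size H.
  by rewrite /edges cardsE (card_uniqP edges_uniq) size_map.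
have -> : \sum_(A in edges H) #|A| = \sum_(A <- H) size A.
  rewrite (eq_bigl (fun A => A \in [seq [set v in A] | A <- H])); last first.
    by move=> A; rewrite inE.
  rewrite -big_uniq //= big_map; apply: eq_big_seq => A AH.
  by rewrite cardsE (card_uniqP (H_uniq A AH)).
by rewrite size_blocks_sum.
Qed.

(** This makes the time bound hold for the empty vertex set, where the bound
    degenerates to a constant. *)
Lemma normalized_empty : #|V| = 0 -> H = [::].
Proof.
move=> V0; case/and3P: H_norm => _ _; case: (H) => // A H' /negP[].
rewrite inE /=; apply/orP; left; apply/eqP/setP => v.
by have := max_card (pred1 v); rewrite card1 V0.
Qed.

End Normalized.

Definition arrays : seq arr :=
  Query :: [seq Main k | k <- iota 1 5] ++ [seq Work k | k <- iota 0 13].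

Lemma forward_chaining_writes : scoped predT (mem arrays) true forward_chaining.
Proof. by []. Qed.

Lemma greedy_writes : scoped predT (mem arrays) true greedy.
Proof. by []. Qed.

Theorem proposition4p2 :
  exists (main p : cmd) (C : nat),
    [/\ main_program main,
        closure_procedure p,
        (forall (V : finType) (H : seq (seq V)),
          exists (tr : seq event) (st : store),
            [/\ exec (oracle_call H) main (init H) tr st,
                closure_computations tr <= #|V| + 1
              & correct H (answer V st)])
      & (forall (V : finType) (H : seq (seq V)),
          normalized H ->
          exists (tr : seq event) (st : store),
            [/\ exec (procedure_call H p) main (init H) tr st,
                closure_computations tr <= #|V| + 1,
                correct H (answer V st),
                time tr <= C * (#|V| * L H).+1
              & space tr <= C * (L H).+1 /\
                words_bounded (C * (L H).+1) tr])].
Proof.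
exists greedy, forward_chaining, (100 * 100); split=> //.
  move=> V H.
  have [tr [st [run _ k _ ok]]] := greedy_runs (@oracle_spec V H _) (ltnSn #|V|).
  by exists tr, st; rewrite addn1.
move=> V H Hn; have LE := normalized_L Hn.
have [H_uniq _ _] := and3P Hn.
have spec := procedure_spec H_uniq (ltnSn _).
have n_lt : #|V| < (#|V| + size (flatten (blocks H))).+1 by lia.
have [tr [st [run tr_t tr_k tr_w ok]]] := greedy_runs spec n_lt.
rewrite -LE in tr_t tr_w spec; exists tr, st; rewrite addn1; split=> //.
  apply: leq_trans tr_t _; have [n0|n_gt0] := posnP #|V|.
    by rewrite LE n0 (normalized_empty Hn n0).
  have nL : #|V| <= L H by rewrite LE leq_addr.
  move: (L H) (#|V|) nL n_gt0 => l n nl n0; clear -nl n0.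
  nia.
have wr : writes_in (mem arrays) tr.
  apply: exec_writes run greedy_writes => st0 tr0 st1 [tr1 [run1 -> _]].
  by apply: exec_writes run1 forward_chaining_writes.
split.
  apply: leq_trans (space_le wr tr_w) _.
  by rewrite [size arrays]/=; lia.
apply: sub_all tr_w => -[|a i y|] //= /andP[iw yw]; lia.
Qed.
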